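(* Fix $0<\theta<\frac16$. Then $$P_N\left(S^{\nearrow}(N)\right)=\frac{N^{-3}}{4\pi\left(1-\frac{(N-t_1-j_1)+(N-t_2-j_2)}{N}\right)^{3/2}\left(\frac{N-t_1-j_1}{N}\right)^{3/2}\left(\frac{N-t_2-j_2}{N}\right)^{3/2}}\left(1+O\!\left(N^{3\theta-\frac12}\right)\right)$$ for $0\prec\!\prec j_1\prec\!\prec N-t_1\prec\!\prec j_2\prec\!\prec N-t_2\prec\!\prec N$. Explicitly: for every $\epsilon>0$ there exist constants $C$ and $N_1$ (depending on $\epsilon$ and $\theta$) such that for all integers $N\ge N_1$ and $j_1,j_2,t_1,t_2$ with $\min\{j_1,\;N-t_1-j_1,\;j_2-(N-t_1),\;N-t_2-j_2,\;t_2\}>\epsilon N$, one has $$P_N\left(S^{\nearrow}(N)\right)=\frac{N^{-3}}{4\pi\left(1-\frac{(N-t_1-j_1)+(N-t_2-j_2)}{N}\right)^{3/2}\left(\frac{N-t_1-j_1}{N}\right)^{3/2}\left(\frac{N-t_2-j_2}{N}\right)^{3/2}}\left(1+\delta\right)$$ for some real number $\delta=\delta(N,t_1,t_2,j_1,j_2)$ with $|\delta|\le CN^{3\theta-1/2}$.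
   Context: $S_N(312)$ is the set of permutations $\sigma=\sigma_1\ldots\sigma_N$ of $1,\dots,N$ for which there are no indices $i_1<i_2<i_3$ with $\sigma_{i_1}>\sigma_{i_3}>\sigma_{i_2}$. $P_N$ is the uniform probability distribution on $S_N(312)$. For $j_1<N-t_1<N-t_2$ and $j_1<j_2<N-t_2$, $S^{\nearrow}(N)=\{\sigma\in S_N(312):\sigma_{N-t_1}=j_1,\ \sigma_{N-t_2}=j_2\}$. The notation $f(N)\prec\!\prec g(N)$ means that there is an $\epsilon>0$ such that $g(N)-f(N)>\epsilon N$ for all sufficiently large $N$; $O$-terms under such conditions are uniform for each fixed $\epsilon$, as spelled out in the claim. *)

(* Defs.v *)
From mathcomp Require Import all_boot all_order all_algebra all_fingroup.
From mathcomp Require Import all_classical all_reals all_analysis.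

Set Implicit Arguments.
Unset Strict Implicit.
Unset Printing Implicit Defensive.

Import Order.TTheory GRing.Theory Num.Theory.

Local Open Scope ring_scope.

(* A permutation of 1..N is encoded as s : 'S_N, a permutation of 0..N-1;
   shifting both positions and values by one preserves patterns. *)
Definition contains312 (N : nat) (s : 'S_N) : bool :=
  [exists i1 : 'I_N, exists i2 : 'I_N, exists i3 : 'I_N,
     [&& (i1 < i2)%N, (i2 < i3)%N, (s i3 < s i1)%N & (s i2 < s i3)%N]].

Definition S312 (N : nat) : {set 'S_N} := [set s : 'S_N | ~~ contains312 s].

Definition P312 (R : realType) (N : nat) (A : {set 'S_N}) : R :=
  #|A :&: S312 N|%:R / #|S312 N|%:R.

(* sigma_p = j with 1-based position p and value j (false unless
   1 <= p, j <= N). *)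
Definition takes_value (N : nat) (s : 'S_N) (p j : int) : bool :=
  [exists i : 'I_N, ((i.+1)%:Z == p) && (((s i).+1)%:Z == j)].

Definition Sup (N : nat) (t1 t2 j1 j2 : int) : {set 'S_N} :=
  [set s in S312 N | takes_value s (N%:Z - t1) j1
                   & takes_value s (N%:Z - t2) j2].

(* Main.v *)
Require Import Defs.
From mathcomp Require Import all_boot all_order all_algebra all_fingroup.
From mathcomp Require Import all_classical all_reals all_analysis.
From mathcomp Require Import ring lra zify.

(** A 312-avoiding permutation is what a stack prints when 1, ..., N are pushed
    in order.  Reading pushes as up-steps and pops as down-steps turns it into a
    Dyck path, and the entry at position p is the value j exactly when the j-th
    up-step is matched with the p-th down-step.  Two prescribed entries whose
    positions and values both increase, with the second value above the first
    position, are therefore two disjoint arches of the path.  If the first one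
    starts at height h1 and the second one at height h2, their interiors are
    Dyck paths of semilengths a + h1 and b + h2, where a and b are the
    differences position minus value.  The rest of the path consists of a walk
    from 0 to h1, a walk from h1 to h2 and a walk from h2 to 0, whose numbers of
    up-steps and of down-steps are determined by the prescribed entries and by
    h1 and h2 ([count_two_points]).

    The sum over h1 and h2 is evaluated by comparison with an exact identity.
    Relevant heights are of order sqrt N, and
    - Catalan numbers satisfy Cat (a + h) = 4 ^ h Cat a (1 + O(h / a))
      ([catalan_growth]);
    - the factor 2 ^ h compensates for stopping a walk at a prescribed number of
      up-steps instead of at a fixed time: 4 ^ K C(s, u) is close to
      C(s + 2 K, u + K), with a relative error of order h / N + h ^ 3 / N ^ 2
      ([bin_shift_le], [bin_shift_ge]).
    After both replacements all walks have fixed lengths, 2 n or 2 n + 1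
    according to parity, and concatenating the three of them yields all Dyck
    paths of four lengths, with sum Cat k + 3 / 4 Cat (k + 1), where
    k = N - a - b - 2 ([sum_arm_bridge_arm]).  This is asymptotically
    Cat (N - a - b) / 4 ([catalan_mix]), so that the probability is asymptotic
    to Cat a Cat b Cat (N - a - b) / (4 Cat N).

    The errors are summed with the functions h + 1 and (h + 1) ^ 3, whose sums
    against the numbers of nonnegative walks are explicit, because odd powers
    vanish at the level -1 where walks are killed; this gives a relative error
    O(N ^ (-1/2)), below the stated one for every positive theta
    ([double_sum_error]).  It remains to use
    Cat n = 4 ^ n / (sqrt pi n ^ (3/2)) (1 + O(1 / n)), which follows from
    two-sided Wallis bounds ([central_lower], [central_upper]). *)

(** * 312-avoiding permutations as outputs of a stack *)

(** An occurrence of 312 starting at x is an increasing pair of later entries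
    below x; the recursive form follows the output of the stack letter by
    letter. *)
Fixpoint avoids312 (t : seq nat) : bool :=
  if t is x :: t' then pairwise geq [seq y <- t' | (y < x)%N] && avoids312 t'
  else true.

(** [L] counts the remaining operations: it is [(N - i).*2 + size s] in every
    state that is reached, two operations for a number still to be pushed and
    one for a number on the stack [s]. *)
Fixpoint stack_outputs (L N i : nat) (s : seq nat) : seq (seq nat) :=
  if L is L'.+1 then
    (if (i < N)%N then stack_outputs L' N i.+1 (i :: s) else [::]) ++
    (if s is x :: s' then [seq x :: t | t <- stack_outputs L' N i s'] else [::])
  else [:: [::]].

(** In a word printed from a given state the entries below [i] are the stack,
    in the order in which it is popped.  Avoidance of 312 makes this sufficient:
    when the word starts with a value [x] that is not on the stack, the later
    entries below [x] decrease, so [i] is printed before the whole stack and may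
    be pushed. *)
Lemma mem_stack_outputs (N i : nat) (s t : seq nat) :
  (i <= N)%N -> pairwise gtn s -> all (ltn^~ i) s ->
  (t \in stack_outputs ((N - i).*2 + size s) N i s) =
  [&& avoids312 t, [seq y <- t | (y < i)%N] == s &
      perm_eq [seq y <- t | (i <= y)%N] (iota i (N - i))].
Proof.
move: {2}(_ + _)%N (erefl ((N - i).*2 + size s)%N) => L.
elim: L i s t => [|L IH] i s t EL iN ps si.
  have s0 : s = [::] by apply: size0nil; lia.
  have Ei : (N - i = 0)%N by lia.
  rewrite EL Ei s0 /= inE.
  apply/eqP/idP => [-> //|/and3P[_ /eqP t1 /perm_size t2]].
  apply: size0nil; rewrite -(count_predC (fun y => y < i)%N) -!size_filter t1 /=.
  rewrite add0n -[RHS]/(size (@nil nat)) -t2; congr size; apply: eq_filter => y /=; lia.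
rewrite EL /= mem_cat.
have pushE : (t \in (if (i < N)%N then stack_outputs L N i.+1 (i :: s) else [::])) =
   [&& (i < N)%N, avoids312 t, [seq y <- t | (y < i.+1)%N] == i :: s
    & perm_eq [seq y <- t | (i < y)%N] (iota i.+1 (N - i.+1))].
  case: (ltnP i N) => //= iN1.
  have EL' : L = ((N - i.+1).*2 + size (i :: s))%N by rewrite /=; lia.
  rewrite {1}EL' IH //=; last by rewrite ltnSn; apply: sub_all si => y /=; lia.
  by rewrite ps andbT; apply: sub_all si => y /=.
have popE : (t \in (if s is x :: s' then [seq x :: t | t <- stack_outputs L N i s'] else [::])) =
   (if s is x :: s' then if t is y :: t' then (x == y) &&
   [&& avoids312 t', [seq y <- t' | (y < i)%N] == s' &
      perm_eq [seq y <- t' | (i <= y)%N] (iota i (N - i))] else false else false).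
  case: s EL ps si {pushE} => [//|x s'] EL /= /andP[_ ps] /andP[_ si].
  have EL' : L = ((N - i).*2 + size s')%N by move: EL => /=; lia.
  case: t => [|y t']; first by apply/mapP => -[].
  apply/mapP/andP => [[t1 t1i [-> ->]]|[/eqP -> tt]].
    by rewrite eqxx -IH // -EL'.
  by exists t'; rewrite // EL' IH.
rewrite pushE popE; apply/orP/idP => [[]|].
- case/and4P => iN1 -> /eqP ti pt.
  have ts : [seq y <- t | y < i] = s.
    rewrite -[LHS](@eq_filter _ (predI (fun y => y < i) (fun y => y < i.+1))%N); last first.
      by move=> y /=; lia.
    by rewrite filter_predI ti /= ltnn; apply/all_filterP.
  rewrite ts eqxx /=.
  have -> : N - i = (N - i.+1).+1 by lia.
  rewrite /= -(perm_filterC (fun y => i < y)%N) -!filter_predI.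
  rewrite (@eq_filter _ _ (fun y => i < y)%N); last by move=> y /=; lia.
  rewrite (@eq_filter _ (predI _ _) (predI (fun y => i <= y) (fun y => y < i.+1))%N); last first.
    by move=> y /=; lia.
  rewrite filter_predI ti /= leqnn.
  have -> : [seq y <- s | i <= y] = [::].
    apply/eqP; rewrite -(negbK (_ == _)) -has_filter -all_predC.
    by apply: sub_all si => y /=; lia.
  by rewrite cats1 perm_rcons perm_cons.
- case: s EL ps si {pushE popE} => // x s' EL /= /andP[xs ps] /andP[xi si].
  case: t => // y t' /andP[/eqP <-] {y} /and3P[at' /eqP ts pt] /=.
  rewrite at' xi leqNgt xi /= pt ts eqxx !andbT.
  have -> : [seq y <- t' | y < x] = [seq y <- s' | y < x].
    rewrite -ts -filter_predI; apply: eq_filter => y /=; lia.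
  have /all_filterP -> : all (fun y => y < x)%N s' by [].
  by apply: sub_pairwise ps => u v /=; lia.
have geq_trans : transitive geq by move=> a b c /= ab bc; apply: leq_trans ab.
have eq_perm (u v : seq nat) : u = v -> perm_eq u v by move=> ->.
case/and3P => at_ /eqP ts pt.
case: t at_ ts pt {pushE popE} => [|x t'] at_ ts pt.
  by move: EL; rewrite -ts; move: pt => /perm_size /=; rewrite size_iota; lia.
case: (ltnP x i) => xi.
  right; move: ts => /=; rewrite xi => <-; rewrite eqxx /=.
  by move: at_ pt => /= /andP[_ ->]; rewrite leqNgt xi eqxx.
left.
have xN : x \in iota i (N - i) by rewrite -(perm_mem pt) mem_filter inE eqxx xi.
have iN1 : i < N by move: xN; rewrite mem_iota; lia.
have EN : N - i = (N - i.+1).+1 by lia.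
rewrite iN1 at_ /=.
have pt1 : perm_eq [seq y <- x :: t' | i < y] (iota i.+1 (N - i.+1)).
  rewrite -[X in perm_eq X](@eq_filter _ (predI (fun y => i < y) (fun y => i <= y))%N); last first.
    by move=> y /=; lia.
  rewrite filter_predI; move/(perm_filter (fun y => i < y)%N): pt; rewrite EN /= ltnn.
  by move/perm_trans; apply; apply/eq_perm/all_filterP/allP => y; rewrite mem_iota; lia.
rewrite pt1 andbT.
have pti : perm_eq [seq y <- x :: t' | y < i.+1] (i :: s).
  rewrite -(perm_filterC (fun y => y < i)%N) -!filter_predI.
  rewrite (@eq_filter _ _ (fun y => y < i)%N) ?ts; last by move=> y /=; lia.
  have /permPr -> : perm_eq (i :: s) (s ++ [:: i]) by rewrite cats1 perm_sym perm_rcons.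
  rewrite perm_cat2l.
  rewrite (@eq_filter _ _ (predI (fun y => y <= i) (fun y => i <= y))%N); last first.
    by move=> y /=; lia.
  rewrite filter_predI; move/(perm_filter (fun y => y <= i)%N): pt; rewrite EN /= leqnn.
  move/perm_trans; apply; rewrite perm_cons; apply/eq_perm/eqP.
  rewrite -(negbK (_ == _)) -has_filter -all_predC; apply/allP => y; rewrite mem_iota /=; lia.
have : sorted geq (i :: s).
  rewrite sorted_pairwise //=.
  by apply/andP; split; [apply: sub_all si => y /=; lia | apply: sub_pairwise ps => y z /=; lia].
have : sorted geq [seq y <- x :: t' | y < i.+1].
  rewrite sorted_pairwise //.
  move: at_ => /= /andP[a1 _].
  case: (ltnP x i.+1) => xi1; last first.
    rewrite (@eq_filter _ _ (predI (fun y => y < i.+1) (fun y => y < x))%N); last first.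
      by move=> y /=; lia.
    by rewrite filter_predI; apply: pairwise_filter.
  have -> : x = i by lia.
  have fx : [seq y <- t' | y < i.+1] = [seq y <- t' | y < x].
    have : uniq [seq y <- x :: t' | i <= y] by rewrite (perm_uniq pt) iota_uniq.
    rewrite /= xi /= mem_filter xi /= => /andP[xt _].
    apply: eq_in_filter => y yt; have : x != y by apply: contraNneq xt => ->.
    lia.
  rewrite /= fx a1 andbT; apply/allP => y; rewrite mem_filter /=; lia.
(* Both lists are decreasing and have the same entries. *)
by move=> s1 s2; apply/eqP/(sorted_eq _ _ s1 s2 pti) => ? ? /=; lia.
Qed.

(** The first operation can be recovered from a word: a pop prints a value
    below [i], whereas after a push of [i] this value is preceded by [i]. *)
Lemma stack_outputs_uniq (N i : nat) (s : seq nat) :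
  (i <= N)%N -> pairwise gtn s -> all (ltn^~ i) s ->
  uniq (stack_outputs ((N - i).*2 + size s) N i s).
Proof.
move: {2}(_ + _)%N (erefl ((N - i).*2 + size s)%N) => L.
elim: L i s => [|L IH] i s EL iN ps si; rewrite EL //= cat_uniq.
have EL1 (iN1 : (i < N)%N) : L = ((N - i.+1).*2 + size (i :: s))%N by rewrite /=; lia.
have ps1 : pairwise gtn (i :: s) by rewrite /= ps andbT; apply: sub_all si => y /=; lia.
have si1 : all (ltn^~ i.+1) (i :: s).
  by rewrite /= ltnSn; apply: sub_all si => y /=; lia.
apply/and3P; split.
- by case: ifP => // iN1; rewrite (EL1 iN1) IH // -EL1.
- case: s EL ps si EL1 ps1 si1 => //= x s' EL /andP[_ ps] /andP[xi si] EL1 ps1 si1.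
  apply/hasPn => _ /mapP[t _ ->]; case: ifP => //= iN1.
  rewrite {1}(EL1 iN1) (mem_stack_outputs N i.+1 [:: i, x & s']) //=.
  rewrite ltnS (ltnW xi) eqseq_cons; case: eqP => [xi'|]; first by rewrite xi' ltnn in xi.
  by rewrite andbF.
case: s EL ps si {EL1 ps1 si1} => //= x s' EL /andP[_ ps] /andP[xi si].
rewrite map_inj_uniq; last by move=> u v [].
have EL' : L = ((N - i).*2 + size s')%N by lia.
by rewrite {1}EL' IH.
Qed.

Definition word (N : nat) (s : 'S_N) : seq nat := [seq val (s i) | i <- enum 'I_N].

Lemma size_word (N : nat) (s : 'S_N) : size (word N s) = N.
Proof. by rewrite size_map size_enum_ord. Qed.

Lemma nth_word (N : nat) (s : 'S_N) (i : 'I_N) : nth 0%N (word N s) i = s i.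
Proof. by rewrite (nth_map i) ?size_enum_ord // nth_ord_enum. Qed.

Lemma word_inj (N : nat) : injective (word N).
Proof.
by move=> s t st; apply/permP => i; apply: val_inj; rewrite /= -!nth_word st.
Qed.

Lemma perm_word (N : nat) (s : 'S_N) : perm_eq (word N s) (iota 0 N).
Proof.
rewrite -val_enum_ord /word (map_comp val s); apply: perm_map.
have ue := enum_uniq 'I_N.
apply: uniq_perm => //; first by rewrite map_inj_uniq //; exact: perm_inj.
move=> i; rewrite mem_enum inE; apply/mapP.
by exists (s^-1 i)%g; rewrite ?mem_enum ?permKV.
Qed.

Lemma word_surj (N : nat) (t : seq nat) :
  perm_eq t (iota 0 N) -> exists s : 'S_N, word N s = t.
Proof.
move=> pt.
have st : size t = N by rewrite (perm_size pt) size_iota.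
have tN (i : 'I_N) : (nth 0 t i < N)%N.
  have : nth 0%N t i \in t by rewrite mem_nth ?st.
  by rewrite (perm_mem pt) mem_iota.
have finj : injective (fun i : 'I_N => Ordinal (tN i)).
  move=> i j [] /eqP; rewrite nth_uniq ?st // => [/eqP /val_inj //|].
  by rewrite (perm_uniq pt) iota_uniq.
exists (perm finj); apply: (@eq_from_nth _ 0%N) => [|i]; rewrite size_word ?st // => iN.
by rewrite (nth_word N _ (Ordinal iN)) permE.
Qed.

Lemma avoids312P (t : seq nat) :
  reflect (forall i1 i2 i3, (i1 < i2 < i3)%N -> (i3 < size t)%N ->
     ~~ ((nth 0 t i3 < nth 0 t i1) && (nth 0 t i2 < nth 0 t i3))%N)
  (avoids312 t).
Proof.
have aux x (u : seq nat) : pairwise geq [seq y <- u | (y < x)%N] =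
    pairwise (fun y z => ~~ ((z < x) && (y < z))%N) u.
  elim: u => //= y u IH; case: ifP => yx /=; rewrite IH.
    by congr andb; elim: u {IH} => //= z u IH; case: ifP => zx /=; rewrite IH //; lia.
  have -> // : all (fun z : nat => ~~ ((z < x) && (y < z))) u by apply/allP => z _; lia.
elim: t => [|x t IH] /=; first by constructor.
rewrite aux; apply: (iffP andP) => [[/(pairwiseP 0%N) p /IH a]|H].
  move=> i1 [|i2] [|i3] /andP[i12 i23] // i3t.
  case: i1 i12 => [|i1] i12; last by apply: a => //=; rewrite -ltnS i12.
  by apply: p; rewrite ?inE //; move: i23 i3t => /=; lia.
split; first by apply/(pairwiseP 0%N) => i j; rewrite !inE => it jt ij; apply: (H 0 i.+1 j.+1).
by apply/IH => i1 i2 i3 i123 i3t; apply: (H i1.+1 i2.+1 i3.+1).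
Qed.

Lemma avoids312_word (N : nat) (s : 'S_N) : avoids312 (word N s) = (s \in S312 N).
Proof.
rewrite inE; apply/avoids312P/negP => [H|H i1 i2 i3 /andP[i12 i23]].
  move=> /existsP[i1 /existsP[i2 /existsP[i3 /and4P[i12 i23 s31 s23]]]].
  have := H i1 i2 i3; rewrite i12 i23 size_word => /(_ isT (ltn_ord i3)).
  by rewrite !nth_word s31 s23.
rewrite size_word => i3N; apply/negP => /andP[s31 s23]; case: H.
have i2N := ltn_trans i23 i3N; have i1N := ltn_trans i12 i2N.
apply/existsP; exists (Ordinal i1N); apply/existsP; exists (Ordinal i2N).
by apply/existsP; exists (Ordinal i3N); rewrite /= i12 i23 -!nth_word s31 s23.
Qed.

Lemma card_S312_count (N : nat) (Q : pred (seq nat)) :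
  #|[set s in S312 N | Q (word N s)]| = count Q (stack_outputs N.*2 N 0 [::]).
Proof.
have genE t : (t \in stack_outputs N.*2 N 0 [::]) = avoids312 t && perm_eq t (iota 0 N).
  have := mem_stack_outputs N 0 [::] t (leq0n N); rewrite subn0 addn0 => -> //.
  rewrite (@eq_filter _ (fun y => y < 0)%N pred0) // filter_pred0 eqxx.
  by rewrite (@eq_filter _ (fun y => 0 <= y)%N predT) // filter_predT.
have gu : uniq (stack_outputs N.*2 N 0 [::]).
  by have := stack_outputs_uniq N 0 [::] (leq0n N); rewrite subn0 addn0 => ->.
rewrite cardE -(size_map (word N)) -size_filter; apply/perm_size/uniq_perm.
- by rewrite map_inj_uniq ?enum_uniq //; exact: word_inj.
- exact: filter_uniq.
move=> t; rewrite mem_filter genE; apply/mapP/idP => [[s]|/and3P[Qt at_ pt]].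
  by rewrite mem_enum inE -avoids312_word => /andP[as_ Qs] ->; rewrite Qs as_ perm_word.
have [s ts] := word_surj N t pt.
by exists s; rewrite ?ts // mem_enum inE -avoids312_word ts at_ Qt.
Qed.

(** * Nonnegative walks *)

(** The numbers of walks with steps +1 and -1 that stay nonnegative; the
    Catalan numbers are [walks n.*2 0 0]. *)
Fixpoint walks (L k h : nat) : nat :=
  if L is L'.+1 then
    walks L' k.+1 h + (if k is k'.+1 then walks L' k' h else 0)
  else (k == h).

Lemma walks_far (L k h : nat) : (L + k < h) || (L + h < k) -> walks L k h = 0.
Proof.
elim: L k => [|L IH] [|k] //= far; rewrite ?IH //; try lia; by case: eqP => // ?; lia.
Qed.

Lemma walks_parity (L k h : nat) : odd (L + k + h) -> walks L k h = 0.
Proof.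
elim: L k => [|L IH] [|k] //= par; rewrite ?IH //; try lia; by case: eqP => // ?; lia.
Qed.

(** Reflection principle: walks that reach -1 correspond to unrestricted
    walks started from [- k - 2], which have [u + k + 1] up-steps. *)
Lemma walks_reflection (k h u d : nat) :
  k + u = h + d -> walks (u + d) k h + 'C(u + d, (u + k).+1) = 'C(u + d, u).
Proof.
move: {2}(u + d) (erefl (u + d)) => L.
elim: L k u d => [|L IH] k u d EL kh.
  have [u0 d0] : u = 0 /\ d = 0 by lia.
  by move: kh; rewrite u0 d0 !addn0 => ->; rewrite /= eqxx.
rewrite EL /= binS.
case: u EL kh => [|u] EL kh.
  rewrite walks_far ?addn0; last by lia.
  case: k kh => [|k] kh; first by lia.
  case: d EL kh => [//|d] EL kh.
  have := IH k 0 d; rewrite !bin0 !add0n => IH'.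
  have dL : d = L by lia.
  by rewrite -dL (@bin_small _ k.+2) ?add0n ?IH' //; lia.
(* First step up; the first step down is [e2] below. *)
have e1 : walks L k.+1 h + 'C(L, (u + k.+1).+1) = 'C(L, u).
  by have := IH k.+1 u d; rewrite (_ : u + d = L); lia.
rewrite binS; case: k kh e1 => [|k] kh e1.
  by rewrite !addn0 addn1 in e1 *; lia.
case: d EL kh => [|d] EL kh.
  rewrite (@walks_far L k h) ?(@bin_small L u.+1) ?(@bin_small L (u.+1 + k.+1)); try lia.
  by rewrite addSnnS addn0 !addn0 add0n.
have e2 : walks L k h + 'C(L, (u.+1 + k).+1) = 'C(L, u.+1).
  by have := IH k u.+1 d; rewrite (_ : u.+1 + d = L); lia.
by move: e1 e2; rewrite !addSn !addnS; lia.
Qed.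

(** Time reversal, read off from the symmetry of the reflection formula. *)
Lemma walksC (L k h : nat) : walks L k h = walks L h k.
Proof.
case: (boolP (odd (L + k + h))) => par; first by rewrite !walks_parity //; lia.
case: (boolP ((L + k < h) || (L + h < k))) => far; first by rewrite !walks_far //; lia.
pose u := ((L + h) - k)./2; pose d := ((L + k) - h)./2.
have Ed : u + d = L by rewrite /u /d; lia.
have Eu : k + u = h + d by rewrite /u /d; lia.
have := walks_reflection k h u d Eu; have := walks_reflection h k d u (esym Eu).
have := bin_sub (leq_addl u d); rewrite addnK (addnC d u) Ed.
have -> : d + h = u + k by lia.
lia.
Qed.

Lemma walks_comp (L L' k h K : nat) : (L + k < K) ->
  \sum_(l < K) walks L k l * walks L' l h = walks (L + L') k h.
Proof.
elim: L k => [|L IH] k kK.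
  rewrite (bigD1 (Ordinal kK)) //= eqxx mul1n big1 ?addn0 // => i ik.
  case: eqP => // e; case/eqP: ik; apply: val_inj; exact/esym.
rewrite addSn /= -IH; last by lia.
case: k kK => [|k] kK.
  by rewrite addn0; apply: eq_bigr => i _; rewrite /= addn0.
rewrite -IH; last by lia.
by rewrite -big_split; apply: eq_bigr => i _; rewrite /= mulnDl.
Qed.

Lemma walks_down (k h : nat) : h <= k -> walks (k - h) k h = 1.
Proof.
elim: k => [|k IH] hk; first by rewrite (_ : h = 0) //; lia.
case: (ltnP k h) => kh; first by rewrite (_ : h = k.+1) ?subnn /= ?eqxx; lia.
by rewrite subSn //= IH // walks_far //; lia.
Qed.

(** * Counting stack outputs with one or two prescribed entries *)

Lemma size_stack_outputs (N i : nat) (s : seq nat) : i <= N ->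
  size (stack_outputs ((N - i).*2 + size s) N i s)
  = walks ((N - i).*2 + size s) (size s) 0.
Proof.
move: {2}(_ + _) (erefl ((N - i).*2 + size s)) => L.
elim: L i s => [|L IH] i s EL iN; rewrite EL /=.
  by have -> : size s = 0 by lia.
rewrite size_cat; congr addn.
  case: (ltnP i N) => iN1; last by rewrite walks_far //; lia.
  have E : (N - i.+1).*2 + size (i :: s) = L by rewrite /=; lia.
  by rewrite -E IH.
case: s EL => // x s EL; have E : (N - i).*2 + size s = L by move: EL => /=; lia.
by rewrite size_map -E IH.
Qed.

Lemma stack_outputs_sub (L N i y : nat) (s t : seq nat) :
  t \in stack_outputs L N i s -> y \in t -> (y \in s) || (i <= y).
Proof.
elim: L i s t => [|L IH] i s t /=; first by rewrite inE => /eqP ->.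
rewrite mem_cat => /orP[].
  case: ifP => // _ tt yt; have := IH _ _ _ tt yt; rewrite inE.
  by case/orP => [/orP[/eqP -> | ->] | /ltnW ->]; rewrite ?leqnn ?orbT.
case: s => // x s /mapP[t' tt ->]; rewrite inE => /orP[/eqP ->|yt].
  by rewrite inE eqxx.
by have := IH _ _ _ tt yt; rewrite inE -orbA => ->; rewrite orbT.
Qed.

(** As long as [j] is on the stack, only the part [s1] above it moves.  Its
    height is a nonnegative walk that must end at 0 after exactly [d] pops; from
    then on the machine only sees [s2]. *)
Lemma count_pop_at (N i j d : nat) (s1 s2 : seq nat) (Q : pred (seq nat)) :
  i <= N -> j < i -> j \notin s1 -> j \notin s2 ->
  count (fun t => (nth N t d == j) && Q (drop d.+1 t))
    (stack_outputs ((N - i).*2 + size (s1 ++ j :: s2)) N i (s1 ++ j :: s2))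
  = walks (d.*2 - size s1) (size s1) 0 *
    (if i + (d - size s1) <= N then
       count Q (stack_outputs ((N - (i + (d - size s1))).*2 + size s2) N
                 (i + (d - size s1)) s2)
     else 0).
Proof.
move: {2}(_ + _) (erefl ((N - i).*2 + size (s1 ++ j :: s2))) => L.
elim: L i d s1 => [|L IH] i d s1 EL iN ji js1 js2.
  by move: EL; rewrite size_cat /=; lia.
rewrite EL /= count_cat.
have -> : count (fun t => (nth N t d == j) && Q (drop d.+1 t))
   (if i < N then stack_outputs L N i.+1 (i :: s1 ++ j :: s2) else [::]) =
   if i < N then walks (d.*2 - (size s1).+1) (size s1).+1 0 *
    (if i.+1 + (d - (size s1).+1) <= N then
       count Q (stack_outputs ((N - (i.+1 + (d - (size s1).+1))).*2 + size s2) N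
                 (i.+1 + (d - (size s1).+1)) s2)
     else 0) else 0.
  case: (ltnP i N) => // iN1.
  have E : (N - i.+1).*2 + size ((i :: s1) ++ j :: s2) = L.
    by move: EL; rewrite /= !size_cat /=; lia.
  rewrite -{1}E -(IH i.+1 d (i :: s1)) //=; first by lia.
  by rewrite inE negb_or js1 andbT; lia.
case: s1 EL js1 => [|x s1] EL js1.
  rewrite /= !subn0.
  have E : (N - i).*2 + size s2 = L by move: EL => /=; lia.
  case: d => [|d].
    rewrite /= mul0n if_same add0n addn0 mul1n iN count_map E.
    by apply: eq_count => t /=; rewrite eqxx drop0.
  rewrite [X in _ + X](_ : _ = 0); last first.
    rewrite count_map; apply/eqP; rewrite -leqn0 leqNgt -has_count -all_predC.
    apply/allP => t tt /=; apply/negP => /andP[/eqP e _].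
    have jt : j \in t.
      rewrite -e mem_nth // ltnNge; apply/negP => /(nth_default N); lia.
    by have := stack_outputs_sub _ _ _ _ _ _ tt jt; rewrite (negbTE js2); lia.
  rewrite doubleS /= !addn0 subn1 /= addSnnS.
  case: (ltnP i N) => // iN1; rewrite ifF ?muln0 //; lia.
move: js1; rewrite inE negb_or eq_sym => /andP[jx js1].
have E : (N - i).*2 + size (s1 ++ j :: s2) = L by move: EL => /=; lia.
rewrite /= count_map.
case: (ltnP d (size s1).+1) => ds.
  rewrite !(@walks_far (d.*2 - _)) ?mul0n ?if_same //; try lia.
  case: d ds => [|d] ds.
    apply/eqP; rewrite add0n -leqn0 leqNgt -has_count -all_predC; apply/allP => t _ /=.
    by rewrite (negbTE jx).
  rewrite -E; have /= -> := IH i d s1 E iN ji js1 js2.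
  by rewrite walks_far //; lia.
case: d ds => [//|d] ds; rewrite -E; have /= -> := IH i d s1 E iN ji js1 js2.
rewrite subSS.
have -> : d.+1.*2 - (size s1).+1 = (d.*2 - size s1).+1 by lia.
rewrite [walks _.+1 _ _]/= mulnDl; congr addn.
have -> : d.+1.*2 - (size s1).+2 = d.*2 - size s1 by lia.
case: (ltnP d (size s1).+1) => ds1.
  by rewrite walks_far ?mul0n ?if_same //; lia.
have -> : i.+1 + (d.+1 - (size s1).+2) = i + (d - size s1) by lia.
by case: (ltnP i N) => // iN1; rewrite ifF ?muln0 //; lia.
Qed.

(** The outputs are sorted by the height [h] of the stack when [j] is pushed.
    There are then [(j - i) + size s - h] earlier pops, so [a + h] pops remain
    before that of [j], and they belong to a Dyck path.  The number [a] is the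
    difference between the position and the value of the prescribed entry, and
    this makes it invariant under both stack operations. *)
Lemma count_push_pop (N a i j K : nat) (s : seq nat) (Q : pred (seq nat))
    (Phi : nat -> nat) :
  i <= j -> j < N -> all (ltn^~ i) s -> j - i + size s < K ->
  (forall s', all (ltn^~ j) s' -> j.+1 + (a + size s') <= N ->
     count Q (stack_outputs ((N - (j.+1 + (a + size s'))).*2 + size s') N
               (j.+1 + (a + size s')) s') = Phi (size s')) ->
  count (fun t => (nth N t (a + (j - i) + size s) == j)
               && Q (drop (a + (j - i) + size s).+1 t))
    (stack_outputs ((N - i).*2 + size s) N i s)
  = \sum_(h < K) walks ((j - i).*2 + size s - h) (size s) h *
      (walks (a + h).*2 0 0 * (if j.+1 + (a + h) <= N then Phi h else 0)).
Proof.
move=> ij jN si sK HQ.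
pose F h := walks (a + h).*2 0 0 * (if j.+1 + (a + h) <= N then Phi h else 0).
under [RHS]eq_bigr => h _ do rewrite -/(F h).
move: {2}(_ + size s) (erefl ((N - i).*2 + size s)) => L.
elim: L i s ij si sK => [|L IH] i s ij si sK EL; first by lia.
rewrite EL /= count_cat (leq_ltn_trans ij jN).
(* After a pop, position and stack height decrease together and [a] is unchanged. *)
have popE : count (fun t => (nth N t (a + (j - i) + size s) == j)
               && Q (drop (a + (j - i) + size s).+1 t))
     (if s is x :: s' then [seq x :: t | t <- stack_outputs L N i s'] else [::]) =
   if s is x :: s' then \sum_(h < K) walks ((j - i).*2 + size s' - h) (size s') h * F h
   else 0.
  case: s EL si sK => // x s EL /= /andP[_ si] sK.
  have E : (N - i).*2 + size s = L by move: EL => /=; lia.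
  rewrite count_map -(IH i s) //; try lia.
  by rewrite -E; apply: eq_count => t /=; rewrite addnS.
rewrite popE {popE}.
case: (ltnP i j) => ij1.
  have si1 : all (ltn^~ i.+1) (i :: s).
    by rewrite /= ltnSn; apply: sub_all si => y /=; lia.
  have E : (N - i.+1).*2 + size (i :: s) = L by rewrite /=; lia.
  have -> : a + (j - i) + size s = a + (j - i.+1) + size (i :: s) by rewrite /=; lia.
  rewrite -{1}E IH //=; last by lia.
  have walksE (h : nat) : walks ((j - i).*2 + size s - h) (size s) h =
     walks ((j - i.+1).*2 + (size s).+1 - h) (size s).+1 h +
     (if s is x :: s' then walks ((j - i).*2 + size s' - h) (size s') h else 0).
    case: (ltnP (j - i + size s) h) => hs.
      rewrite !walks_far; try lia.
      by case: s {si1 si EL sK E} hs => // x s /= hs; rewrite walks_far //; lia.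
    have -> : (j - i).*2 + size s - h = ((j - i).*2 + (size s).-1 - h + (0 < size s)).-1.+1.
      by case: (s) hs => [|x s'] /=; lia.
    rewrite /=; congr addn; first by congr walks; case: (s) hs => [|x s'] /=; lia.
    case: (s) hs => // x s' /= hs; congr walks; lia.
  rewrite [RHS](eq_bigr (fun h : 'I_K =>
     walks ((j - i.+1).*2 + (size s).+1 - h) (size s).+1 h * F h
     + (if s is x :: s' then walks ((j - i).*2 + size s' - h) (size s') h else 0) * F h)); last first.
    by move=> h _; rewrite walksE mulnDl.
  rewrite big_split /=; congr addn.
  by case: (s) => [|x s'] //=; rewrite big1.
have Ei : i = j by apply/eqP; rewrite eqn_leq ij ij1.
rewrite {}Ei {i ij ij1} in EL si sK *.
rewrite !subnn !addn0 doubleE /= !add0n.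
have E : (N - j.+1).*2 + size ([::] ++ j :: s) = L by rewrite /=; lia.
have jns : j \notin s by apply/negP => /(allP si) /=; rewrite ltnn.
rewrite -{1}E count_pop_at //= subn0 subn0.
have FE : walks (a + size s).*2 0 0 *
  (if j.+1 + (a + size s) <= N
   then count Q (stack_outputs ((N - (j.+1 + (a + size s))).*2 + size s) N (j.+1 + (a + size s)) s)
   else 0) = F (size s).
  by rewrite /F; case: ifP => // h; rewrite HQ.
rewrite FE.
have walksE (h : nat) : walks (size s - h) (size s) h = (size s == h) +
     (if s is x :: s' then walks (size s' - h) (size s') h else 0).
  case: (s) => [|x s'] /=; first by rewrite ?sub0n ?addn0.
  case: (ltngtP (size s').+1 h) => hs.
  - by rewrite !walks_far //; lia.
  - by rewrite !walks_down //; lia.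
  - by rewrite -hs subnn [walks 0 _ _]/= eqxx walks_far //; lia.
rewrite [RHS](eq_bigr (fun h : 'I_K => (size s == h) * F h
     + (if s is x :: s' then walks (size s' - h) (size s') h else 0) * F h)); last first.
  by move=> h _; rewrite walksE mulnDl.
rewrite big_split /=; congr addn.
  have sK' : size s < K by lia.
  rewrite (bigD1 (Ordinal sK')) //= eqxx mul1n big1 ?addn0 // => h hs.
  by case: eqP => // e; case/eqP: hs; apply: val_inj.
by case: (s) => [|x s'] //=; rewrite big1.
Qed.

(** The second value [n + a + 1 + m] exceeds the first position [n + a], so
    it is not yet pushed when the first prescribed entry is printed, unless more
    than [m] elements are then left on the stack; in that case it was printed
    before, and there is no contribution. *)
Lemma count_two_points (n a m b n' N K : nat) :
  N = n + a + m + b + n' + 2 -> N <= K ->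
  count (fun t => (nth N t (n + a) == n) &&
                  (nth N t (n + a + 1 + m + b) == n + a + 1 + m))
    (stack_outputs N.*2 N 0 [::])
  = \sum_(h1 < K) \sum_(h2 < K)
      walks (n.*2 - h1) 0 h1 * walks (a + h1).*2 0 0 *
      (if (h1 <= m) && (h2 <= m) then walks (m.*2 - (h1 + h2)) h1 h2 else 0) *
      (walks (b + h2).*2 0 0 * walks (n'.*2 - h2) 0 h2).
Proof.
move=> EN NK.
pose Phi2 h := walks (n'.*2 - h) 0 h.
pose Phi1 h := if h <= m then \sum_(l < K) walks ((m - h).*2 + h - l) h l *
   (walks (b + l).*2 0 0 * (if n + a + 1 + m + 1 + (b + l) <= N then Phi2 l else 0)) else 0.
pose Q t := (nth N t (m + b) == n + a + 1 + m) && predT (drop (m + b).+1 t).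
have := @count_push_pop N a 0 n K [::] Q Phi1 (leq0n n).
rewrite !subn0 !addn0 /= => main.
rewrite (eq_count (a2 := fun t => (nth N t (a + n) == n) && Q (drop (a + n).+1 t))); last first.
  move=> t; rewrite /Q /= andbT nth_drop (addnC a n); congr (_ && (nth _ _ _ == _)); lia.
rewrite main; try lia.
  apply: eq_bigr => h1 _; rewrite /Phi1 mulnA.
  case: (leqP h1 m) => h1m; last first.
    by rewrite if_same muln0; symmetry; apply: big1 => h2 _; rewrite mul0n.
  rewrite ifT; last by lia.
  rewrite big_distrr /=; apply: eq_bigr => h2 _.
  case: (leqP h2 m) => h2m; last first.
    rewrite muln0 mul0n (@walks_far (_ + h1 - _)) ?mul0n ?muln0 //; lia.
  rewrite -!mulnA; congr (_ * (_ * (_ * (_ * _)))); first by congr walks; lia.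
  rewrite /Phi2; case: ifP => // h; rewrite walks_far //; lia.
move=> s all_s sN; rewrite /Phi1; case: (leqP (size s) m) => sm; last first.
  apply/eqP; rewrite -leqn0 leqNgt -has_count -all_predC; apply/allP => t tt /=.
  apply/negP => /andP[/eqP e _].
  have jt : n + a + 1 + m \in t.
    rewrite -e mem_nth // ltnNge; apply/negP => /(nth_default N); lia.
  have := stack_outputs_sub _ _ _ _ _ _ tt jt; case: (boolP (_ \in s)) => [/(allP all_s) /=|_]; lia.
have Ei : n + a + 1 + m - (n.+1 + (a + size s)) = m - size s by lia.
have := @count_push_pop N b (n.+1 + (a + size s)) (n + a + 1 + m) K s predT Phi2.
rewrite Ei (_ : b + (m - size s) + size s = m + b); last by lia.
rewrite /Q => ->; try lia.
- by apply: eq_bigr => l _; rewrite (addn1 (_ + m)).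
- by apply: sub_all all_s => y /=; lia.
move=> s' _ s'N; rewrite count_predT size_stack_outputs // /Phi2 walksC; congr walks; lia.
Qed.

Import Order.TTheory GRing.Theory Num.Theory numFieldNormedType.Exports.

Local Open Scope ring_scope.

Lemma takes_valueE (N : nat) (s : 'S_N) (p j : nat) : (p < N)%N ->
  takes_value s p.+1%:Z j.+1%:Z = (nth N (word N s) p == j).
Proof.
move=> pN; have -> : nth N (word N s) p = s (Ordinal pN).
  by rewrite (set_nth_default 0%N) ?size_word // -(nth_word N s (Ordinal pN)).
apply/existsP/eqP => [[i /andP[/eqP [ip] /eqP [ij]]]|e].
  by rewrite -ij; congr (nat_of_ord (s _)); apply: val_inj.
by exists (Ordinal pN); rewrite /= e !eqxx.
Qed.

Lemma card_S312_catalan (N : nat) : #|S312 N| = walks N.*2 0 0.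
Proof.
have <- : [set s in S312 N | predT (word N s)] = S312 N.
  by apply/setP => s; rewrite inE andbT.
rewrite card_S312_count count_predT.
by have := size_stack_outputs N 0 [::] (leq0n N); rewrite subn0 addn0.
Qed.

Lemma card_Sup (n a m b n' N K : nat) (t1 t2 j1 j2 : int) :
  N = (n + a + m + b + n' + 2)%N -> (N <= K)%N ->
  j1 = n.+1%:Z -> N%:Z - t1 = (n + a).+1%:Z ->
  j2 = (n + a + 1 + m).+1%:Z -> N%:Z - t2 = (n + a + 1 + m + b).+1%:Z ->
  #|Sup N t1 t2 j1 j2 :&: S312 N| =
  (\sum_(h1 < K) \sum_(h2 < K)
      walks (n.*2 - h1) 0 h1 * walks (a + h1).*2 0 0 *
      (if (h1 <= m) && (h2 <= m) then walks (m.*2 - (h1 + h2)) h1 h2 else 0) *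
      (walks (b + h2).*2 0 0 * walks (n'.*2 - h2) 0 h2))%N.
Proof.
move=> EN NK E1 E2 E3 E4.
rewrite -(count_two_points n a m b n' N K EN NK) -card_S312_count.
apply: eq_card => s; rewrite !inE E1 E2 E3 E4 !takes_valueE; lia.
Qed.

(** * Binomial and Catalan numbers *)

Lemma catalan_bin (n : nat) : (n.+1 * walks n.*2 0 0 = 'C(n.*2, n))%N.
Proof.
have := walks_reflection 0 0 n n erefl; rewrite addnn addn0.
by have := mul_bin_left n.*2 n; nia.
Qed.

(** The product form of the reflection formula; unlike the difference of
    binomial coefficients it displays the linear decay near height 0. *)
Lemma ballot (h d : nat) :
  ((h + d).+1 * walks (h + d + d) 0 h = h.+1 * 'C(h + d + d, h + d))%N.
Proof.
have := walks_reflection 0 h (h + d) d (add0n _); rewrite addn0.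
have := mul_bin_left (h + d + d) (h + d); rewrite addKn.
by move: (walks _ _ _) 'C(_, _) 'C(_, _) => w b c; nia.
Qed.

Lemma bin_centralS (n : nat) :
  ('C(n.+1.*2, n.+1) * n.+1 = 2 * n.*2.+1 * 'C(n.*2, n))%N.
Proof.
have e1 := mul_bin_diag n.*2.+2 n; have e2 := mul_bin_down n.*2.+1 n.
have e3 : (n.*2.+1 - n = n.+1)%N by lia.
rewrite e3 /= in e2; rewrite /= in e1.
rewrite doubleS; apply/eqP; rewrite -(eqn_pmul2l (ltn0Sn n)); apply/eqP.
nia.
Qed.

Lemma catalanS (n : nat) :
  (n.+2 * walks n.+1.*2 0 0 = 2 * n.*2.+1 * walks n.*2 0 0)%N.
Proof.
rewrite catalan_bin; apply/eqP; rewrite -(eqn_pmul2r (ltn0Sn n)) bin_centralS.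
by rewrite -catalan_bin -!mulnA [(n.+1 * _)%N]mulnC.
Qed.

Lemma walks_le_bin (L k h : nat) : exists u, (walks L k h <= 'C(L, u))%N.
Proof.
case: (boolP (odd (L + k + h))) => par; first by exists 0%N; rewrite walks_parity.
case: (boolP ((L + k < h) || (L + h < k))%N) => far; first by exists 0%N; rewrite walks_far.
pose u := ((L + h) - k)./2; pose d := ((L + k) - h)./2.
have Ed : (u + d = L)%N by rewrite /u /d; lia.
have Eu : (k + u = h + d)%N by rewrite /u /d; lia.
by exists u; have := walks_reflection k h u d Eu; rewrite Ed; lia.
Qed.

Lemma bin_le_central (n x : nat) : ('C(n.*2, x) <= 'C(n.*2, n))%N.
Proof.
have lower i : ('C(n.*2, n - i) <= 'C(n.*2, n))%N.
  elim: i => [|i IH]; first by rewrite subn0.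
  case: (leqP n i) => ni; first by rewrite (_ : n - i.+1 = n - i)%N //; lia.
  apply: leq_trans IH; have := mul_bin_left n.*2 (n - i.+1).
  have -> : (n - i.+1).+1 = (n - i)%N by lia.
  have -> : (n.*2 - (n - i.+1) = n + i.+1)%N by lia.
  by rewrite -(leq_pmul2l (_ : 0 < n - i)%N) => [->|]; [rewrite leq_mul2r; lia | lia].
case: (leqP x n) => xn; first by rewrite -(subKn xn).
case: (leqP x n.*2) => x2; last by rewrite bin_small.
by rewrite -bin_sub // (_ : n.*2 - x = n - (x - n))%N //; lia.
Qed.

Lemma bin_le_central_odd (n x : nat) : ('C(n.*2.+1, x) <= 2 * 'C(n.*2, n))%N.
Proof.
case: x => [|x]; first by rewrite bin0 muln_gt0 /= bin_gt0; lia.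
by rewrite binS mulSn mul1n leq_add // bin_le_central.
Qed.

Lemma bin_near_le_central (R : realFieldType) (n x : nat) (c : bool) :
  'C(n.*2 + c, x)%:R / 2 ^+ c <= 'C(n.*2, n)%:R :> R.
Proof.
case: c; rewrite /= ?addn0 ?addn1 ?expr0 ?expr1 ?divr1 ?ler_nat ?bin_le_central //.
by rewrite ler_pdivrMr // mulrC -natrM ler_nat bin_le_central_odd.
Qed.

Lemma bin_diag_step (s u K : nat) : (u <= s)%N ->
  ((s + K.*2).+2 * (s + K.*2).+1 * 'C(s + K.*2, u + K)
   = (u + K).+1 * (s - u + K).+1 * 'C((s + K.*2).+2, (u + K).+1))%N.
Proof.
move=> us; have e1 := mul_bin_diag (s + K.*2).+2 (u + K).
have e2 := mul_bin_down (s + K.*2).+1 (u + K).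
rewrite /= in e1 e2.
have e3 : ((s + K.*2).+1 - (u + K) = (s - u + K).+1)%N by lia.
by rewrite e3 in e2; rewrite -mulnA e2 mulnCA e1; lia.
Qed.

(** Increasing [K] by one multiplies the quotient of the left-hand side by
    the binomial coefficient on the right by
    [4 (u + K + 1) (v + K + 1) / ((s + 2 K + 2) (s + 2 K + 1))], with
    [v = s - u]; by the inequality between arithmetic and geometric means this
    is at most [1 + 1 / (s + 2 K + 1)]. *)
Lemma bin_shift_le (R : realFieldType) (s u K : nat) :
  4 ^+ K * 'C(s, u)%:R <= 'C(s + K.*2, u + K)%:R * (1 + K%:R / s.+1%:R) :> R.
Proof.
have s0 : 0 < s.+1%:R :> R by rewrite ltr0n.
case: (leqP u s) => us; last first.
  by rewrite bin_small // mulr0 mulr_ge0 ?addr_ge0 ?divr_ge0.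
elim: K => [|K IH].
  by rewrite expr0 mul1r mul0r addr0 mulr1 !addn0.
have := congr1 (fun k => k%:R : R) (bin_diag_step s u K us).
rewrite doubleS !addnS !natrM.
set B := 'C(s + K.*2, u + K)%:R in IH *; set B' := 'C(_.+2, _)%:R => E.
have B'0 : 0 <= B' by [].
have := IH; set A := _ * 'C(s, u)%:R => {}IH; rewrite exprS -mulrA -/A.
set p := (s + K.*2).+2%:R in E; set q := (s + K.*2).+1%:R in E.
have q0 : 0 < q by rewrite ltr0n.
have p0 : 0 < p by rewrite ltr0n.
have pq : p = q + 1 by rewrite /p -natr1.
(* The two factors on the left add up to [p]. *)
have am : 4 * ((u + K).+1%:R * (s - u + K).+1%:R) <= p ^+ 2.
  have -> : p = (u + K).+1%:R + (s - u + K).+1%:R by rewrite -natrD; congr _%:R; lia.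
  by have := sqr_ge0 ((u + K).+1%:R - (s - u + K).+1%:R : R); lra.
have BB : 4 * B <= B' * (p / q).
  rewrite -(ler_pM2l (mulr_gt0 p0 q0)).
  have -> : p * q * (4 * B) = 4 * (p * q * B) by ring.
  rewrite E.
  have -> : p * q * (B' * (p / q)) = p ^+ 2 * B' by field; rewrite -!natrD ?nat1r pnatr_eq0.
  by rewrite mulrA ler_wpM2r.
have k0 : 0 <= 1 + K%:R / s.+1%:R :> R by rewrite addr_ge0 ?divr_ge0.
apply: (le_trans (y := 4 * B * (1 + K%:R / s.+1%:R))); first by rewrite -[leRHS]mulrA ler_pM2l.
apply: (le_trans (ler_wpM2r k0 BB)).
rewrite -mulrA ler_wpM2l //.
have -> : p / q = 1 + q^-1 by rewrite pq mulrDl mul1r divff // gt_eqF.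
have qs : (s.+1 + K)%:R <= q by rewrite ler_nat; lia.
have qs' : q^-1 * (s.+1 + K)%:R <= 1 by rewrite mulrC ler_pdivrMr ?mul1r.
rewrite natrD in qs'.
have -> : 1 + K.+1%:R / s.+1%:R = (1 + K%:R / s.+1%:R) + 1 / s.+1%:R :> R.
  by rewrite -natr1; ring.
rewrite mulrDl [1 * (_ + _)]mul1r lerD2l.
rewrite ler_pdivlMr //.
have -> // : q^-1 * (1 + K%:R / s.+1%:R) * s.+1%:R = q^-1 * (s.+1%:R + K%:R).
by field; rewrite -!natrD ?nat1r !pnatr_eq0.
Qed.

(** The quotient of consecutive terms is also at least
    [1 - ((u - v) / (s + 2 K + 2)) ^ 2], where [u - v = 2 u - s]. *)
Lemma bin_shift_ge (R : realFieldType) (s u K : nat) :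
  'C(s + K.*2, u + K)%:R * (1 - K%:R * ((2 * u%:R - s%:R) / s.+1%:R) ^+ 2)
    <= 4 ^+ K * 'C(s, u)%:R :> R.
Proof.
have s0 : 0 < s.+1%:R :> R by rewrite ltr0n.
set x := (_ / _) ^+ 2; have x0 : 0 <= x by exact: sqr_ge0.
case: (leqP u s) => us; last first.
  rewrite (@bin_small s u) // mulr0; case: K => [|K]; first by rewrite !addn0 bin_small ?mul0r.
  rewrite mulr_ge0_le0 // subr_le0.
  (* Here [u > s], so [2 u - s] is at least [s + 1]. *)
  have x1 : 1 <= x.
    rewrite exprn_ege1 // ler_pdivlMr // mul1r.
    have : u%:R >= s.+1%:R :> R by rewrite ler_nat.
    have : s.+1%:R = s%:R + 1 :> R by rewrite natr1.
    have : 0 <= s%:R :> R by []. lra.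
  have : 1 <= K.+1%:R :> R by rewrite ler1n.
  by move: (K.+1%:R) => k k1; nra.
elim: K => [|K IH].
  by rewrite expr0 mul1r mul0r subr0 mulr1 !addn0.
have := congr1 (fun k => k%:R : R) (bin_diag_step s u K us).
rewrite doubleS !addnS !natrM.
set B := 'C(s + K.*2, u + K)%:R in IH *; set B' := 'C(_.+2, _)%:R => E.
have B'0 : 0 <= B' by [].
have := IH; set A := _ * 'C(s, u)%:R => {}IH; rewrite exprS -mulrA -/A.
have A0 : 0 <= A by rewrite mulr_ge0 ?exprn_ge0.
case: (leP (1 - K.+1%:R * x) 0) => xK.
  by apply: (@le_trans _ _ 0); rewrite ?mulr_ge0_le0 // mulr_ge0.
have xK' : 0 <= 1 - K%:R * x.
  by move: xK; rewrite -natr1 => xK; lra.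
have BB : B' * (1 - x) <= 4 * B.
  set p := (s + K.*2).+2%:R in E; set q := (s + K.*2).+1%:R in E.
  have q0 : 0 < q by rewrite ltr0n.
  have p0 : 0 < p by rewrite ltr0n.
  have qp : q <= p by rewrite ler_nat.
  rewrite -(ler_pM2l (mulr_gt0 p0 q0)).
  have -> : p * q * (4 * B) = 4 * (p * q * B) by ring.
  rewrite E.
  have -> : p * q * (B' * (1 - x)) = p * q * (1 - x) * B' by ring.
  rewrite mulrA ler_wpM2r //.
  have Ep : p = (u + K).+1%:R + (s - u + K).+1%:R by rewrite -natrD; congr _%:R; lia.
  have Ed : 2 * u%:R - s%:R = (u + K).+1%:R - (s - u + K).+1%:R :> R.
    rewrite -!natr1 !natrD natrB //; ring.
  have sp : s.+1%:R <= p :> R by rewrite ler_nat; lia.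
  have xp : (2 * u%:R - s%:R) ^+ 2 <= p ^+ 2 * x :> R.
    rewrite /x expr_div_n mulrA ler_pdivlMr ?exprn_gt0 // mulrC ler_wpM2r ?sqr_ge0 //.
    by rewrite ler_pXn2r // nnegrE ltW.
  have x1 : 0 <= 1 - x.
    have := xK; rewrite -natr1; have : 0 <= K%:R * x by rewrite mulr_ge0. lra.
  have h1 : p * q * (1 - x) <= p * p * (1 - x) by rewrite ler_wpM2r // ler_wpM2l // ltW.
  apply: (le_trans h1).
  move: xp; rewrite Ed Ep.
  set a := (u + K).+1%:R; set b := (s - u + K).+1%:R => xp; lra.
apply: (le_trans (y := 4 * B * (1 - K%:R * x))); last by rewrite -[leLHS]mulrA ler_pM2l.
apply: le_trans (ler_wpM2r xK' BB).
rewrite -mulrA ler_wpM2l // -natr1.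
have : 0 <= K%:R * x * x by rewrite -mulrA mulr_ge0 // -expr2 sqr_ge0.
by move: x {x0 IH xK xK' BB} => x; lra.
Qed.

(** * Replacing stopped walks by walks of fixed length *)

(** The relative error of the local comparisons at height [y], when all
    numbers of steps are at least [M].  For [y] of order [sqrt M] it is of order
    [1 / sqrt M]; it exceeds 1 as soon as [y] exceeds [M], so that it also
    covers trivial estimates at large heights. *)
Definition local_err (R : realFieldType) (M y : R) : R := y / M + y ^+ 3 / M ^+ 2.

Lemma local_err_ge0 (R : realFieldType) (M y : R) : 0 < M -> 0 <= y -> 0 <= local_err R M y.
Proof. by move=> M0 y0; rewrite addr_ge0 ?divr_ge0 ?exprn_ge0 // ltW. Qed.

Lemma local_err_ge1 (R : realFieldType) (M y : R) : 0 < M -> M <= y -> 1 <= local_err R M y.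
Proof.
move=> M0 My; have y0 := le_trans (ltW M0) My.
apply: (@le_trans _ _ (y / M)); first by rewrite ler_pdivlMr // mul1r.
by rewrite lerDl divr_ge0 ?exprn_ge0 // ltW.
Qed.

(** Nonnegative walks of the fixed length [2 n] or [2 n + 1], whichever has the
    parity of [h], on the scale of the walks of length [2 n]. *)
Definition arm (R : realFieldType) (n h : nat) : R :=
  (walks (n.*2 + odd h) 0 h)%:R / 2 ^+ odd h.

(** A walk with exactly [n] up-steps ending at height [h], followed by an arch
    of semilength [a + h] which is compared with one of semilength [a].  The
    factor 4 ^ h by which the Catalan number grows is shared with the
    walk on the other side of the arch: each of them gets 2 ^ h. *)
Definition stopped_arm (R : realFieldType) (n a h : nat) : R :=
  (walks (n.*2 - h) 0 h)%:R * (walks (a + h).*2 0 0)%:R * 2 ^+ h /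
  (4 ^+ h * (walks a.*2 0 0)%:R).

Lemma arm_ge0 (R : realFieldType) (n h : nat) : 0 <= arm R n h.
Proof. by rewrite divr_ge0 ?exprn_ge0. Qed.

Lemma catalan_gt0 (n : nat) : (0 < walks n.*2 0 0)%N.
Proof. by rewrite -(ltn_pmul2l (ltn0Sn n)) muln0 catalan_bin bin_gt0; lia. Qed.

(** The quotient of consecutive Catalan numbers is [4 - 6 / (n + 2)]. *)
Lemma catalan_growth (R : realFieldType) (a h : nat) : (0 < a)%N ->
  let k := (walks (a + h).*2 0 0)%:R / (4 ^+ h * (walks a.*2 0 0)%:R) : R in
  1 - 2 * h%:R / a%:R <= k <= 1.
Proof.
move=> a0 /=; have c0 : 0 < (walks a.*2 0 0)%:R :> R by rewrite ltr0n catalan_gt0.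
have aR : 0 < a%:R :> R by rewrite ltr0n.
elim: h => [|h IH].
  by rewrite addn0 expr0 mul1r mulr0 mul0r subr0 divff ?lexx // gt_eqF.
have := congr1 (fun k => k%:R : R) (catalanS (a + h)).
rewrite addnS !natrM; set w' := (walks (a + h).+1.*2 _ _)%:R.
move: IH; set w := (walks (a + h).*2 _ _)%:R => IH E.
set c := (walks a.*2 0 0)%:R in c0 IH *.
have p0 : 0 < (a + h).+2%:R :> R by rewrite ltr0n.
set r := 2 * (a + h).*2.+1%:R / (4 * (a + h).+2%:R) : R.
have -> : w' / (4 ^+ h.+1 * c) = w / (4 ^+ h * c) * r.
  have -> : w' = 2 * (a + h).*2.+1%:R * w / (a + h).+2%:R by rewrite -E mulrC mulKf ?gt_eqF.
  rewrite /r exprS; move: (_.+2%:R) p0 (_.+1%:R) => p p0 q.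
  by field; rewrite !gt_eqF ?exprn_gt0.
set k := w / _ in IH *; have /andP[k1 k2] := IH.
have k0 : 0 <= k by rewrite /k divr_ge0 ?mulr_ge0 ?exprn_ge0.
have r1 : r <= 1.
  rewrite /r ler_pdivrMr ?mulr_gt0 // mul1r -!natrM ler_nat; lia.
have r2 : 1 - 2 / a%:R <= r.
  rewrite /r ler_pdivlMr ?mulr_gt0 //.
  have -> : (1 - 2 / a%:R) * (4 * (a + h).+2%:R) =
     4 * (a + h).+2%:R - 8 * ((a + h).+2%:R / a%:R) :> R by ring.
  have : 1 <= (a + h).+2%:R / a%:R :> R by rewrite ler_pdivlMr // mul1r ler_nat; lia.
  have -> : (a + h).*2.+1%:R = 2 * (a + h)%:R + 1 :> R by rewrite -natr1 -mul2n natrM.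
  have -> : (a + h).+2%:R = (a + h)%:R + 2 :> R by rewrite -natrD addn2.
  by move: (_ / a%:R) => f f1; lra.
have -> : 1 - 2 * h.+1%:R / a%:R = 1 - 2 * h%:R / a%:R - 2 / a%:R :> R.
  by rewrite -natr1; ring.
have r0 : 0 <= r by rewrite /r divr_ge0 ?mulr_ge0.
have kr : 0 <= (1 - k) * (1 - r) by rewrite mulr_ge0 ?subr_ge0.
move: k r k0 r0 k1 k2 r1 r2 kr {IH} => k r k0 r0 k1 k2 r1 r2 kr.
by apply/andP; split; [lra | rewrite mulr_ile1].
Qed.

Lemma expr2_uphalf (R : realFieldType) (h : nat) :
  2 ^+ h = 4 ^+ uphalf h / 2 ^+ odd h :> R.
Proof.
have -> : 4 = 2 ^+ 2 :> R by rewrite expr2 -natrM.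
rewrite -exprM; have -> : (2 * uphalf h = h + odd h)%N by lia.
by rewrite exprD mulfK // expf_neq0 // pnatr_eq0.
Qed.

Lemma local_err_dominates (R : realFieldType) (M p D K y : R) :
  0 < M -> M <= p -> 0 <= K -> K <= y -> D ^+ 2 <= y ^+ 2 -> K / p + K * (D / p) ^+ 2 <= local_err R M y.
Proof.
move=> M0 Mp K0 Ky Dy; have p0 := lt_le_trans M0 Mp.
have y0 := le_trans K0 Ky.
rewrite /local_err lerD //; first by rewrite ler_pM ?invr_ge0 ?lef_pV2 ?posrE // ltW.
have KD : 0 <= K * D ^+ 2 by apply: mulr_ge0; rewrite // sqr_ge0.
rewrite expr_div_n mulrA ler_pM ?invr_ge0 ?sqr_ge0 //.
  by rewrite [leRHS]exprS ler_pM ?sqr_ge0.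
by rewrite lef_pV2 ?posrE ?exprn_gt0 // ler_pXn2r ?nnegrE // ltW.
Qed.

(** Both sides are [h + 1] times a binomial coefficient, up to explicit
    factors, by the ballot formula.  The error has to be relative to [arm],
    which is smaller than the binomial coefficient by a factor of order
    [h / n]. *)
Lemma stopped_walk_near_arm (R : realFieldType) (M : R) (n h : nat) :
  0 < M -> M <= n%:R ->
  let beta := (walks (n.*2 - h) 0 h)%:R * 2 ^+ h : R in
  beta <= 4 * arm R n h /\
  `|beta - arm R n h| <= 3 * arm R n h * local_err R M h.+1%:R.
Proof.
move=> M0 Mn beta; have al0 := arm_ge0 R n h.
have e0 : 0 <= local_err R M h.+1%:R by rewrite local_err_ge0.
case: (ltnP n h) => nh.
  have b0 : beta = 0 by rewrite /beta walks_far ?mul0r //; lia.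
  rewrite b0 sub0r normrN (ger0_norm al0) mulr_ge0 //; split=> //.
  have e1 : 1 <= local_err R M h.+1%:R.
    by apply: local_err_ge1 => //; apply: le_trans Mn _; rewrite ler_nat; lia.
  by rewrite [leRHS]mulrAC ler_peMl //; lra.
have [d Ed] : exists d, n = (h + d)%N by exists (n - h)%N; lia.
pose K := uphalf h; pose s := (n.*2 - h)%N.
have Kh : (K <= h.+1)%N by rewrite /K; lia.
have Kn : (K <= n.+1)%N by rewrite /K; lia.
have KE : (K.*2 = h + odd h)%N by rewrite /K; lia.
have Es2 : (s + K.*2 = n.*2 + odd h)%N by rewrite /s; lia.
have E1 := congr1 (fun k => k%:R : R) (ballot h d).
have E2 := congr1 (fun k => k%:R : R) (ballot h (d + K)).
move: E1 E2; rewrite !addnA -Ed !natrM.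
have -> : (n + d = s)%N by rewrite /s; lia.
have -> : (n + K + d + K = s + K.*2)%N by rewrite /s; lia.
have up := bin_shift_le R s n K; have lo := bin_shift_ge R s n K.
have Es : s.+1%:R >= n.+1%:R :> R by rewrite ler_nat /s; lia.
have aE : arm R n h * 2 ^+ odd h = (walks (s + K.*2) 0 h)%:R.
  rewrite /arm divfK ?expf_neq0 ?pnatr_eq0 //.
  by rewrite Es2.
have sD : 2 * n%:R - s%:R = h%:R :> R by rewrite /s natrB -?addnn ?natrD; [ring | lia].
rewrite sD in lo.
set x := K%:R / s.+1%:R in up; set z := K%:R * (h%:R / s.+1%:R) ^+ 2 in lo.
rewrite -aE; set A := 'C(s, n)%:R in up lo *; set B := 'C(s + _, _)%:R in up lo *.
move=> E1 E2.
have n0 : 0 < n.+1%:R :> R by rewrite ltr0n.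
have h0 : 0 < h.+1%:R :> R by rewrite ltr0n.
have o0 : 0 < 2 ^+ odd h :> R by rewrite exprn_gt0.
have EnK : (n + K).+1%:R = n.+1%:R + K%:R :> R by rewrite -natrD.
rewrite EnK in E2.
have bA : n.+1%:R * (beta * 2 ^+ odd h) = h.+1%:R * (4 ^+ K * A).
  rewrite [RHS]mulrCA -E1 /beta expr2_uphalf -/K -/s.
  by rewrite -(mulrA (walks _ _ _)%:R) divfK ?gt_eqF //; ring.
pose k := K%:R / n.+1%:R : R.
have k0 : 0 <= k by rewrite divr_ge0.
have k1 : k <= 1 by rewrite ler_pdivrMr // mul1r ler_nat.
have kE : n.+1%:R + K%:R = n.+1%:R * (1 + k) :> R.
  by rewrite mulrDr mulr1 /k mulrC divfK ?gt_eqF.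
(* From here on only [k <= 1] and [k + z <= local_err] matter. *)
have xk : x <= k by rewrite /x /k ler_wpM2l // lef_pV2 ?posrE // ltr0n.
have x0 : 0 <= x by rewrite divr_ge0.
have z0 : 0 <= z by rewrite mulr_ge0 ?sqr_ge0.
have kz : k + z <= local_err R M h.+1%:R.
  apply: (le_trans (y := k + K%:R * (h%:R / n.+1%:R) ^+ 2)).
    rewrite lerD2l ler_wpM2l // ler_pXn2r ?nnegrE ?divr_ge0 //.
    by rewrite ler_wpM2l // lef_pV2 ?posrE // ltr0n.
  apply: local_err_dominates => //; first by rewrite (le_trans Mn) // ler_nat.
    by rewrite ler_nat.
  by rewrite ler_pXn2r ?nnegrE // ler_nat.
have scale u v : n.+1%:R * (2 ^+ odd h) * u <= n.+1%:R * (2 ^+ odd h) * v -> u <= v :> R.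
  by rewrite ler_pM2l // mulr_gt0.
have b1 : beta <= arm R n h * ((1 + k) * (1 + x)).
  apply: scale.
  have -> : n.+1%:R * 2 ^+ odd h * beta = h.+1%:R * (4 ^+ K * A) by rewrite -bA; ring.
  have -> : n.+1%:R * 2 ^+ odd h * (arm R n h * ((1 + k) * (1 + x))) =
    h.+1%:R * (B * (1 + x)).
    by rewrite [RHS]mulrA -E2 kE; ring.
  by rewrite ler_wpM2l.
have b2 : arm R n h * ((1 + k) * (1 - z)) <= beta.
  apply: scale.
  have -> : n.+1%:R * 2 ^+ odd h * beta = h.+1%:R * (4 ^+ K * A) by rewrite -bA; ring.
  have -> : n.+1%:R * 2 ^+ odd h * (arm R n h * ((1 + k) * (1 - z))) =
    h.+1%:R * (B * (1 - z)).
    by rewrite [RHS]mulrA -E2 kE; ring.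
  by rewrite ler_wpM2l.
move: (arm R n h) (local_err R M _) al0 b1 b2 e0 kz {E1 E2 aE bA} => al e al0 b1 b2 e0 kz.
move: x z k {up lo kE} x0 z0 k0 k1 xk b1 b2 kz => x z k x0 z0 k0 k1 xk b1 b2 kz.
have u1 : (1 + k) * (1 + x) <= 1 + 3 * k.
  have : 0 <= (1 - x) * k by rewrite mulr_ge0 // subr_ge0; lra.
  lra.
have u2 : 1 - 2 * z <= (1 + k) * (1 - z).
  have : 0 <= (1 - k) * z by rewrite mulr_ge0 // subr_ge0.
  lra.
have b3 := le_trans b1 (ler_wpM2l al0 u1).
have b4 := le_trans (ler_wpM2l al0 u2) b2.
have ak : al * (k + z) <= al * e by rewrite ler_wpM2l.
have az : 0 <= al * z by rewrite mulr_ge0.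
have ak0 : 0 <= al * k by rewrite mulr_ge0.
split; first by have : 0 <= al * (1 - k) by [rewrite mulr_ge0 ?subr_ge0]; lra.
rewrite ler_norml; apply/andP; split; lra.
Qed.

Lemma stopped_arm_near_arm (R : realFieldType) (M : R) (n a h : nat) :
  0 < M -> M <= n%:R -> M <= a%:R ->
  0 <= stopped_arm R n a h <= 4 * arm R n h /\
  `|stopped_arm R n a h - arm R n h| <= 5 * arm R n h * local_err R M h.+1%:R.
Proof.
move=> M0 Mn Ma; have [b4 b3] := stopped_walk_near_arm R M n h M0 Mn.
have a0 : (0 < a)%N by rewrite -(ltr0n R) (lt_le_trans M0).
have /andP[k1 k2] := catalan_growth R a h a0.
set k := (walks (a + h).*2 _ _)%:R / _ in k1 k2.
have gE : stopped_arm R n a h = (walks (n.*2 - h) 0 h)%:R * 2 ^+ h * k.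
  by rewrite /stopped_arm /k; ring.
have k0 : 0 <= k by rewrite /k divr_ge0 ?mulr_ge0 ?exprn_ge0.
set beta := _ * 2 ^+ h in b3 b4 gE.
have be0 : 0 <= beta by rewrite mulr_ge0 ?exprn_ge0.
have al0 := arm_ge0 R n h.
clearbody k beta.
rewrite gE mulr_ge0 //; split; first by rewrite (le_trans _ b4) // ler_piMr.
have he : h%:R / a%:R <= local_err R M h.+1%:R.
  rewrite -[_ / _]addr0 lerD ?divr_ge0 ?exprn_ge0 ?(ltW M0) //.
  by rewrite ler_pM ?invr_ge0 ?lef_pV2 ?posrE ?ler_nat // (lt_le_trans M0).
rewrite -mulrA in k1.
set e := local_err _ _ _ in he b3 *; move: (h%:R / a%:R) he k1 => f he k1.
clearbody e.
have -> : beta * k - arm R n h = k * (beta - arm R n h) + arm R n h * (k - 1) by ring.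
apply: le_trans (ler_normD _ _) _.
rewrite (normrM k) (normrM (arm _ _ _)) (ger0_norm k0) (ger0_norm al0).
have -> : 5 * arm R n h * e = 3 * arm R n h * e + arm R n h * (2 * e) by ring.
apply: lerD; first by rewrite (le_trans _ b3) // ler_piMl.
by rewrite ler_wpM2l // ler_norml; apply/andP; split; lra.
Qed.

(** The analogue of [arm] for the walk between the two arches. *)
Definition bridge (R : realFieldType) (m h1 h2 : nat) : R :=
  (walks (m.*2 + odd (h1 + h2)) h1 h2)%:R / 2 ^+ odd (h1 + h2).

(** The walk between the arches has [m - h1] up-steps and [m - h2] down-steps,
    hence the case distinction and the length [m.*2 - (h1 + h2)]. *)
Definition stopped_bridge (R : realFieldType) (m h1 h2 : nat) : R :=
  (if (h1 <= m)%N && (h2 <= m)%N then walks (m.*2 - (h1 + h2)) h1 h2 else 0%N)%:R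
  * 2 ^+ (h1 + h2).

Lemma bridge_bounds (R : realFieldType) (m h1 h2 : nat) :
  0 <= bridge R m h1 h2 <= 'C(m.*2, m)%:R.
Proof.
rewrite divr_ge0 ?exprn_ge0 //=.
have [u wu] := walks_le_bin (m.*2 + odd (h1 + h2)) h1 h2.
apply: le_trans (bin_near_le_central R m u (odd (h1 + h2))).
by rewrite ler_pM2r ?invr_gt0 ?exprn_gt0 // ler_nat.
Qed.

(** For [H] up to [m] the shift bounds apply with denominators at least [m];
    beyond, the trivial bound [K] for the relative error is already smaller than
    [local_err]. *)
Lemma bin_shift_err (R : realFieldType) (M : R) (m H u : nat) :
  0 < M -> M <= m%:R -> (H <= m.*2)%N -> (m <= u + H)%N -> (u <= m.+1)%N ->
  `|('C(m.*2 - H, u))%:R * 2 ^+ H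
    - ('C(m.*2 + odd H, u + uphalf H))%:R / 2 ^+ odd H|
  <= 4 * 'C(m.*2, m)%:R * local_err R M H.+1%:R :> R.
Proof.
move=> M0 Mm Hm um mu; pose K := uphalf H; pose s := (m.*2 - H)%N.
have Es : (s + K.*2 = m.*2 + odd H)%N by rewrite /K /s; lia.
have KH : (K <= H)%N by rewrite /K; lia.
have sm : (H <= m)%N -> (m <= s)%N by rewrite /s; lia.
rewrite -/s expr2_uphalf -/K -Es.
have o0 : 0 < 2 ^+ odd H :> R by rewrite exprn_gt0.
have mid := bin_near_le_central R m (u + K) (odd H); rewrite -Es in mid.
have up := bin_shift_le R s u K; have lo := bin_shift_ge R s u K.
rewrite mulrA -mulrBl normrM normfV (ger0_norm (ltW o0)) [_ * 4 ^+ K]mulrC.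
set A := _ * 'C(s, u)%:R in up lo *; set B := 'C(_, u + K)%:R in up lo mid *.
have B0 : 0 <= B by [].
have A0 : 0 <= A by rewrite mulr_ge0 ?exprn_ge0.
suff AB : `|A - B| <= B * (4 * local_err R M H.+1%:R).
  rewrite ler_pdivrMr //; apply: le_trans AB _.
  rewrite [leRHS](_ : _ = 'C(m.*2, m)%:R * 2 ^+ odd H * (4 * local_err R M H.+1%:R)); last by ring.
  by rewrite ler_wpM2r ?mulr_ge0 ?local_err_ge0 // -ler_pdivrMr.
have s0 : 0 < s.+1%:R :> R by rewrite ltr0n.
case: (leqP H m) => Hm1; last first.
  have Ks : K%:R / s.+1%:R <= K%:R :> R by rewrite ler_pdivrMr // ler_peMr // ler1n.
  have e1 : H.+1%:R <= local_err R M H.+1%:R.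
    have h0 : 0 < H.+1%:R :> R by rewrite ltr0n.
    rewrite /local_err -[leLHS]add0r lerD ?divr_ge0 ?(ltW M0) //.
    rewrite ler_pdivlMr ?exprn_gt0 // [leRHS]exprS ler_pM2l // ler_pXn2r ?nnegrE ?ltW //.
    by rewrite (le_lt_trans Mm) // ltr_nat (ltn_trans Hm1).
  have K1 : 1 + K%:R <= H.+1%:R :> R by rewrite nat1r ler_nat.
  have up' : A <= B * (1 + K%:R) by rewrite (le_trans up) // ler_wpM2l // lerD2l.
  have Be : B * (1 + K%:R) <= B * local_err R M H.+1%:R by rewrite ler_wpM2l // (le_trans K1).
  have BK : 0 <= B * K%:R by rewrite mulr_ge0.
  by rewrite ler_norml; apply/andP; split; lra.
have {}sm := sm Hm1.
set D := 2 * u%:R - s%:R in lo.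
have D2 : D ^+ 2 <= (2 * H.+1%:R) ^+ 2.
  have Dl : - (2 * H.+1%:R) <= D.
    rewrite /D /s natrB // -addnn natrD.
    have : m%:R <= u%:R + H%:R :> R by rewrite -natrD ler_nat.
    have : 0 <= H%:R :> R by [].
    rewrite -(natr1 H); lra.
  have Dr : D <= 2 * H.+1%:R.
    rewrite /D /s natrB // -addnn natrD.
    have : u%:R <= m%:R + 1 :> R by rewrite natr1 ler_nat.
    have : 0 <= H%:R :> R by [].
    rewrite -(natr1 H); lra.
  by rewrite -[leLHS]real_normK ?num_real // ler_pXn2r ?nnegrE ?mulr_ge0 // ler_norml Dl.
have K0 : 0 <= K%:R / s.+1%:R :> R by rewrite divr_ge0.
have KD0 : 0 <= K%:R * (D / s.+1%:R) ^+ 2 by apply: mulr_ge0; rewrite // sqr_ge0.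
have {}KH : K%:R <= H.+1%:R :> R by rewrite ler_nat leqW.
have Ms : M <= s.+1%:R by rewrite (le_trans Mm) // ler_nat leqW.
(* The imbalance [D] may reach [2 (H + 1)]; halving it costs the factor 4. *)
have D4 : (D / 2) ^+ 2 <= H.+1%:R ^+ 2.
  by rewrite expr_div_n ler_pdivrMr ?exprn_gt0 // mulrC -exprMn.
have := local_err_dominates R M s.+1%:R (D / 2) K%:R H.+1%:R M0 Ms (ler0n _ _) KH D4.
have -> : (D / 2 / s.+1%:R) ^+ 2 = (D / s.+1%:R) ^+ 2 / 4 by field; rewrite nat1r pnatr_eq0.
move: (local_err _ _ _) (K%:R / s.+1%:R) ((D / _) ^+ 2) up lo K0 KD0 => e x d up lo K0 KD0 xd.
have xe : B * (x + K%:R * d) <= B * (4 * e) by rewrite ler_wpM2l //; lra.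
have Bx : 0 <= B * x by rewrite mulr_ge0.
have Bd : 0 <= B * (K%:R * d) by rewrite mulr_ge0.
by rewrite ler_norml; apply/andP; split; lra.
Qed.

(** The reflection formula gives a difference of two binomial coefficients,
    and the error is taken relative to the central one.  This ignores their
    cancellation at small heights, where the arms on both sides are already
    small. *)
Lemma stopped_bridge_near_bridge (R : realFieldType) (M : R) (m h1 h2 : nat) :
  0 < M -> M <= m%:R ->
  `|stopped_bridge R m h1 h2 - bridge R m h1 h2|
    <= 8 * 'C(m.*2, m)%:R * local_err R M (h1 + h2).+1%:R.
Proof.
move=> M0 Mm; have /andP[om0 om1] := bridge_bounds R m h1 h2.
have C0 : 0 <= 'C(m.*2, m)%:R :> R by [].
rewrite /stopped_bridge; case: ifP => hm; last first.
  rewrite mul0r sub0r normrN ger0_norm //; apply: (le_trans om1).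
  have e1 : 1 <= local_err R M (h1 + h2).+1%:R.
    by apply: local_err_ge1 => //; apply: le_trans Mm _; rewrite ler_nat; lia.
  by rewrite mulrAC ler_peMl //; lra.
have /andP[h1m h2m] := hm; set H := (h1 + h2)%N.
have b1 := bin_shift_err R M m H (m - h1) M0 Mm.
have b2 := bin_shift_err R M m H m.+1 M0 Mm.
have w1 : (walks (m.*2 - H) h1 h2 + 'C(m.*2 - H, m.+1) = 'C(m.*2 - H, m - h1))%N.
  have := walks_reflection h1 h2 (m - h1) (m - h2).
  have -> : (m - h1 + (m - h2) = m.*2 - H)%N by rewrite /H; lia.
  have -> : (m - h1 + h1 = m)%N by lia.
  by apply; lia.
have w2 : (walks (m.*2 + odd H) h1 h2 + 'C(m.*2 + odd H, m.+1 + uphalf H)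
   = 'C(m.*2 + odd H, m - h1 + uphalf H))%N.
  have := walks_reflection h1 h2 (m - h1 + uphalf H) (m - h2 + uphalf H).
  have -> : (m - h1 + uphalf H + (m - h2 + uphalf H) = m.*2 + odd H)%N by rewrite /H; lia.
  have -> : ((m - h1 + uphalf H + h1).+1 = m.+1 + uphalf H)%N by lia.
  by apply; rewrite /H; lia.
have [H2 mH mH1] : [/\ H <= m.*2, m <= m - h1 + H & m - h1 <= m.+1]%N.
  by rewrite /H; split; lia.
have mH2 : (m <= m.+1 + H)%N by lia.
move: (b1 H2 mH mH1) (b2 H2 mH2 (leqnn _)) => {b1 b2}; rewrite -w1 -w2 !natrD /bridge -/H.
move: (walks _ _ _)%:R (walks _ _ _)%:R 'C(_, m.+1)%:R 'C(_, _ + uphalf H)%:R => u2 u1 v1 v2.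
rewrite !(mulrDl _ _ (2 ^+ H)) !(mulrDl _ _ (2 ^+ odd H)^-1) => c1 c2.
have -> : u1 * 2 ^+ H - u2 / 2 ^+ odd H =
  (u1 * 2 ^+ H + v1 * 2 ^+ H - (u2 / 2 ^+ odd H + v2 / 2 ^+ odd H))
  - (v1 * 2 ^+ H - v2 / 2 ^+ odd H) by ring.
apply: (le_trans (ler_normB _ _)); apply: (le_trans (lerD c1 c2)).
by rewrite le_eqVlt; apply/orP; left; apply/eqP; ring.
Qed.

(** * Wallis bounds for the central binomial coefficient *)

(** The primitives of the powers of the cosine that integration by parts
    produces, vanishing at 0: their values at [pi / 2] are the Wallis
    integrals. *)
Fixpoint cosX_primitive (R : realType) (n : nat) : R -> R :=
  match n with
  | 0 => id
  | 1 => sin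
  | m.+2 => ((m.+2%:R)^-1 : R) *:
      (cos ^+ m.+1 * sin + (m.+1%:R : R) *: cosX_primitive R m)
  end.

Lemma is_derive_cosX_primitive (R : realType) (n : nat) (x : R) :
  is_derive x 1 (cosX_primitive R n) (cos x ^+ n).
Proof.
elim/ltn_ind: n => -[|[|n]] IH /=.
- by rewrite expr0; exact: is_derive_id.
- by rewrite expr1; exact: is_derive_sin.
have dn := IH n (ltnW (ltnSn _)).
have dc := is_deriveX n.+1 (is_derive_cos x).
have := is_deriveZ ((n.+2%:R)^-1 : R)
  (is_deriveD (is_deriveM dc (is_derive_sin x)) (is_deriveZ (n.+1%:R : R) dn)).
move/is_derive_eq; apply; rewrite /= /GRing.scale /=.
have -> : (cos ^+ n.+1 : R -> R) x = cos x ^+ n.+1.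
  by elim: (n.+1) => [|k IHk]; rewrite ?expr0 // !exprS -IHk.
have n0 : (1 + n.+1%:R : R) != 0 by rewrite nat1r pnatr_eq0.
have -> : n.+2%:R = 1 + n.+1%:R :> R by rewrite nat1r.
have := cos2Dsin2 x; set c := cos x; set s := sin x => E.
have {}E : s ^+ 2 = 1 - c ^+ 2 by rewrite -E; ring.
rewrite !exprS; set p := c ^+ n.
transitivity ((1 + n.+1%:R)^-1 * (c * c * p + n.+1%:R * p * (1 - s ^+ 2))); first by ring.
by rewrite E; field.
Qed.

(** The integral of [cos ^+ n] over the interval from 0 to [pi / 2]. *)
Definition wallis (R : realType) (n : nat) : R := cosX_primitive R n (pi / 2).

Lemma wallis1 (R : realType) : wallis R 1 = 1.
Proof. exact: sin_pihalf. Qed.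

Lemma wallisSS (R : realType) (n : nat) :
  wallis R n.+2 = n.+1%:R / n.+2%:R * wallis R n.
Proof.
rewrite /wallis /= /GRing.scale /= /GRing.scale /=.
transitivity (n.+2%:R^-1 * ((cos ^+ n.+1 : R -> R) (pi / 2) * sin (pi / 2) +
  n.+1%:R * cosX_primitive R n (pi / 2))) => //.
have -> : (cos ^+ n.+1 : R -> R) (pi / 2) = 0.
  by rewrite exprS; transitivity (cos (pi / 2) * (cos ^+ n : R -> R) (pi / 2));
    rewrite // cos_pihalf mul0r.
by rewrite mul0r add0r mulrCA mulrA.
Qed.

Lemma cosX_primitive0 (R : realType) (n : nat) : cosX_primitive R n 0 = 0.
Proof.
elim/ltn_ind: n => -[|[|n]] IH //=; first exact: sin0.
transitivity ((n.+2%:R^-1 : R) * ((cos ^+ n.+1 : R -> R) 0 * sin 0 +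
  n.+1%:R * cosX_primitive R n 0)) => //.
by rewrite IH 1?ltnW // sin0 !mulr0 addr0 mulr0.
Qed.

(** The difference of the two primitives is nondecreasing, because its
    derivative [cos x ^+ n * (1 - cos x)] is nonnegative. *)
Lemma wallis_nincr (R : realType) (n : nat) : wallis R n.+1 <= wallis R n.
Proof.
pose f : R -> R := cosX_primitive R n - cosX_primitive R n.+1.
have df (x : R) : is_derive x 1 f (cos x ^+ n - cos x ^+ n.+1).
  by apply: is_deriveB; exact: is_derive_cosX_primitive.
have fc : continuous f.
  by move=> x; apply/differentiable_continuous/derivable1_diffP/ex_derive.
have pi0 : 0 <= pi / 2 :> R by have /andP[/ltW] := pihalf_02 R.
have [c cI fE] := MVT_segment pi0 (fun x _ => df x)
  (continuous_subspaceT fc).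
have : 0 <= f (pi / 2) - f 0.
  rewrite fE subr0 mulr_ge0 // subr_ge0 exprS ler_piMl ?cos_le1 // exprn_ge0 //.
  move: cI; rewrite in_itv /= => /andP[c0 cpi]; apply: cos_ge0_pihalf.
  by rewrite cpi andbT (le_trans _ c0) // oppr_le0.
have -> : f 0 = 0.
  by transitivity (cosX_primitive R n 0 - cosX_primitive R n.+1 0);
    rewrite // !cosX_primitive0 subrr.
by rewrite subr0 subr_ge0.
Qed.

Definition central (R : realType) (n : nat) : R := 'C(n.*2, n)%:R / 4 ^+ n.

Lemma central_gt0 (R : realType) (n : nat) : 0 < central R n.
Proof. by rewrite divr_gt0 ?exprn_gt0 // ltr0n bin_gt0; lia. Qed.

Lemma centralS (R : realType) (n : nat) :
  central R n.+1 = n.*2.+1%:R / n.*2.+2%:R * central R n.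
Proof.
have E : ('C(n.+1.*2, n.+1) * n.*2.+2 = 4 * n.*2.+1 * 'C(n.*2, n))%N.
  have e : (n.*2.+2 = 2 * n.+1)%N by lia.
  by rewrite e mulnCA bin_centralS -[4%N]/(2 * 2)%N !mulnA.
have := congr1 (fun k => k%:R : R) E; rewrite !natrM => {}E.
rewrite /central exprS; have h : n.*2.+2%:R != 0 :> R by rewrite pnatr_eq0.
have h4 : (4 : R) ^+ n != 0 by rewrite expf_neq0.
apply: (mulIf h); apply: (mulIf h4).
transitivity ('C(n.+1.*2, n.+1)%:R * n.*2.+2%:R / 4 : R); first by field; rewrite h4.
by rewrite E; field; rewrite h4 -natrD pnatr_eq0.
Qed.

Lemma wallis_even (R : realType) (n : nat) :
  wallis R n.*2 = pi / 2 * central R n.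
Proof.
elim: n => [|n IH]; first by rewrite /central expr0 bin0 divr1 mulr1.
by rewrite doubleS wallisSS IH centralS mulrCA.
Qed.

Lemma wallis_odd (R : realType) (n : nat) :
  wallis R n.*2.+1 * (n.*2.+1%:R * central R n) = 1.
Proof.
elim: n => [|n IH]; first by rewrite /central expr0 bin0 divr1 mulr1 wallis1 mul1r.
rewrite doubleS wallisSS centralS -[RHS]IH.
by field; rewrite -!natrD !pnatr_eq0.
Qed.

Lemma central_lower (R : realType) (n : nat) :
  2 <= pi * n.*2.+1%:R * central R n ^+ 2.
Proof.
have := wallis_nincr R n.*2.
have c0 := central_gt0 R n; have n0 : 0 < n.*2.+1%:R :> R by rewrite ltr0n.
rewrite -(ler_pM2r (mulr_gt0 n0 c0)) wallis_odd wallis_even.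
set c := central R n; set k := n.*2.+1%:R => h.
have -> : pi * k * c ^+ 2 = 2 * (pi / 2 * c * (k * c)) by field.
by rewrite -{1}[2]mulr1 ler_pM2l.
Qed.

Lemma central_upper (R : realType) (n : nat) : pi * n%:R * central R n ^+ 2 <= 1.
Proof.
case: n => [|n]; first by rewrite mulr0 mul0r.
have := wallis_nincr R n.*2.+1.
have c0 := central_gt0 R n; have n0 : 0 < n.*2.+1%:R :> R by rewrite ltr0n.
rewrite -(ler_pM2r (mulr_gt0 n0 c0)) wallis_odd -doubleS wallis_even.
have -> : n.*2.+1%:R * central R n = n.*2.+2%:R * central R n.+1.
  by rewrite centralS; field; rewrite -!natrD pnatr_eq0.
rewrite (_ : n.*2.+2 = 2 * n.+1)%N ?natrM; last by lia.
by rewrite (_ : _ * (_ * _) = pi * n.+1%:R * central R n.+1 ^+ 2) //; field.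
Qed.

(** * Summation over the two heights *)

Lemma sum_walks0 (k K : nat) (f : nat -> nat) : (k < K)%N ->
  (\sum_(h < K) walks 0 k h * f h = f k)%N.
Proof.
move=> kK; rewrite (bigD1 (Ordinal kK)) //= eqxx mul1n big1 ?addn0 // => i ik.
by case: eqP => // e; case/eqP: ik; apply: val_inj.
Qed.

(** The function [h + 1] is harmonic for the walk killed at -1. *)
Lemma sum_walks_succ (L k K : nat) :
  (L + k < K)%N -> (\sum_(h < K) walks L k h * h.+1 = 2 ^ L * k.+1)%N.
Proof.
elim: L k => [|L IH] k LK; first by rewrite sum_walks0 // expn0 mul1n.
case: k LK => [|k] LK /=.
  under eq_bigr do rewrite addn0.
  by rewrite IH ?expnS; lia.
under eq_bigr do rewrite mulnDl.
by rewrite big_split /= !IH ?expnS; lia.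
Qed.

(** With [y = h + 1] one has [(y + 1) ^ 3 + (y - 1) ^ 3 = 2 y ^ 3 + 6 y], and
    the cube vanishes at the killing level [y = 0]. *)
Lemma sum_walks_cube (L k K : nat) : (L + k < K)%N ->
  (\sum_(h < K) walks L k h * h.+1 ^ 3 = 2 ^ L * (k.+1 ^ 3 + 3 * L * k.+1))%N.
Proof.
elim: L k => [|L IH] k LK; first by rewrite (sum_walks0 k K (fun h => h.+1 ^ 3)%N); lia.
case: k LK => [|k] LK /=.
  under eq_bigr do rewrite addn0.
  by rewrite IH ?expnS; lia.
under eq_bigr do rewrite mulnDl.
rewrite big_split /= !IH; try lia.
by rewrite expnS !expnS !expn0; move: (2 ^ L)%N => p; nia.
Qed.

(** Only even heights contribute, and the reflection formula telescopes. *)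
Lemma sum_even_walks (n K : nat) :
  (\sum_(h < K.*2) walks n.*2 0 h + 'C(n.*2, n + K) = 'C(n.*2, n))%N.
Proof.
elim: K => [|K IH]; first by rewrite big_ord0 addn0.
rewrite doubleS !big_ord_recr /= -IH -!addnA; congr addn.
rewrite (@walks_parity n.*2 0 K.*2.+1) ?add0n; last by lia.
case: (leqP K n) => Kn.
  have := walks_reflection 0 K.*2 (n + K) (n - K).
  have -> : (n + K + (n - K) = n.*2)%N by lia.
  by rewrite addn0 -addnS; apply; lia.
by rewrite walks_far ?bin_small //; lia.
Qed.

Lemma sum_walks_le (n K : nat) : (\sum_(h < K) walks n.*2 0 h <= 'C(n.*2, n))%N.
Proof.
have := sum_even_walks n K; rewrite -addnn big_split_ord /= => <-.
by rewrite -addnA leq_addr.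
Qed.

(** A walk of length [2 n + 1] extends one of length [2 n], in at most two ways. *)
Lemma sum_walks_odd_le (n K : nat) :
  (\sum_(h < K) walks n.*2.+1 0 h <= 2 * 'C(n.*2, n))%N.
Proof.
have E h : walks n.*2.+1 0 h =
    (\sum_(l < n.*2.+1) walks n.*2 0 l * walks 1 l h)%N.
  by rewrite walks_comp ?addn1 // addn0.
under eq_bigr do rewrite E.
rewrite exchange_big /=.
apply: (@leq_trans (\sum_(l < n.*2.+1) 2 * walks n.*2 0 l)); last first.
  by rewrite -big_distrr leq_mul2l sum_walks_le.
apply: leq_sum => l _; rewrite -big_distrr /= mulnC leq_mul2r; apply/orP; right.
have le1 (k : nat) : (\sum_(h < K) (k == h) <= 1)%N.
  case: (ltnP k K) => kK.
    by have := sum_walks0 k K (fun=> 1%N) kK; under eq_bigr do rewrite muln1; move=> ->.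
  by rewrite big1 // => h _; case: eqP => // e; have := ltn_ord h; rewrite -e ltnNge kK.
case: {E}(nat_of_ord l) => [|k].
  apply: leq_trans (leqnSn 1); under eq_bigr do rewrite /= addn0.
  exact: (le1 1%N).
by rewrite big_split /= -[2%N]addn1 leq_add // ?(le1 k.+2) ?(le1 k).
Qed.

Lemma arm_parity (R : realFieldType) (n h : nat) :
  arm R n h = (walks n.*2 0 h)%:R + (walks n.*2.+1 0 h)%:R / 2.
Proof.
rewrite /arm; case: (boolP (odd h)) => oh; rewrite ?addn0 ?addn1.
  by rewrite expr1 (@walks_parity n.*2) ?add0r //; lia.
by rewrite expr0 divr1 (@walks_parity n.*2.+1) ?mul0r ?addr0 //; lia.
Qed.

Lemma sum_arm_le (R : realFieldType) (n K : nat) :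
  \sum_(h < K) arm R n h <= 2 * 'C(n.*2, n)%:R.
Proof.
under eq_bigr do rewrite arm_parity.
rewrite big_split /= -mulr_suml -!natr_sum.
have h1 : (\sum_(h < K) walks n.*2 0 h)%:R <= 'C(n.*2, n)%:R :> R.
  by rewrite ler_nat sum_walks_le.
have h2 : (\sum_(h < K) walks n.*2.+1 0 h)%:R <= 2 * 'C(n.*2, n)%:R :> R.
  by rewrite -natrM ler_nat sum_walks_odd_le.
lra.
Qed.

Lemma sum_arm_err (R : realFieldType) (M : R) (n K : nat) : 0 < M -> (n.*2.+1 < K)%N ->
  \sum_(h < K) arm R n h * local_err R M h.+1%:R
  = 4 ^+ n * (2 / M + (12 * n%:R + 5) / M ^+ 2).
Proof.
move=> M0 nK.
have E (h : 'I_K) : arm R n h * local_err R M h.+1%:R =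
    ((walks n.*2 0 h * h.+1)%:R + (walks n.*2.+1 0 h * h.+1)%:R / 2) / M +
    ((walks n.*2 0 h * h.+1 ^ 3)%N%:R + (walks n.*2.+1 0 h * h.+1 ^ 3)%N%:R / 2) / M ^+ 2.
  by rewrite arm_parity /local_err !(natrM _ (walks _ _ _)) !natrX; ring.
under eq_bigr do rewrite E.
rewrite !(big_split, =^~ mulr_suml, =^~ natr_sum).
have -> := sum_walks_succ n.*2 0 K; last by lia.
have -> := sum_walks_succ n.*2.+1 0 K; last by lia.
have -> := sum_walks_cube n.*2 0 K; last by lia.
have -> := sum_walks_cube n.*2.+1 0 K; last by lia.
rewrite !expnS -mul2n expnM !exp1n !natrM !natrD !natrX !natrM.
have -> : (2 : R) ^+ 2 = 4 by rewrite expr2 -natrM.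
have -> : (2 * n).+1%:R = 2 * n%:R + 1 :> R by rewrite -natr1 natrM.
by rewrite /=; field; rewrite gt_eqF.
Qed.

Lemma sum_walks3 (A B C K : nat) : (A + B < K)%N ->
  (\sum_(h1 < K) \sum_(h2 < K) walks A 0 h1 * walks B h1 h2 * walks C 0 h2
   = walks (A + B + C) 0 0)%N.
Proof.
move=> K0; rewrite exchange_big /=.
rewrite -(@walks_comp _ _ _ _ K) ?addn0 //; apply: eq_bigr => h2 _.
by rewrite -(@walks_comp _ _ _ _ K) ?addn0; [rewrite big_distrl /= walksC | lia].
Qed.

(** Each choice of the parities of the two heights fixes the three lengths,
    and concatenation then counts Dyck paths: of semilength [n + m + n'] when
    both heights are even, and of semilength [n + m + n' + 1], with weight 1/4,
    in the three other cases. *)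
Lemma sum_arm_bridge_arm (R : realFieldType) (n m n' K : nat) :
  (n.*2 + m.*2 + 2 < K)%N ->
  \sum_(h1 < K) \sum_(h2 < K) arm R n h1 * bridge R m h1 h2 * arm R n' h2
  = (walks (n + m + n').*2 0 0)%:R + 3 / 4 * (walks (n + m + n').+1.*2 0 0)%:R.
Proof.
move=> nK; pose T (s1 s2 : bool) (h1 h2 : nat) : nat :=
  (walks (n.*2 + s1) 0 h1 * walks (m.*2 + (s1 (+) s2)) h1 h2 * walks (n'.*2 + s2) 0 h2)%N.
have TE (s1 s2 : bool) : (\sum_(h1 < K) \sum_(h2 < K) T s1 s2 h1 h2)%N =
    walks (n.*2 + s1 + (m.*2 + (s1 (+) s2)) + (n'.*2 + s2)) 0 0.
  by rewrite sum_walks3 //; case: s1 s2 => [] [] /=; lia.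
have E (h1 h2 : 'I_K) : arm R n h1 * bridge R m h1 h2 * arm R n' h2 =
    (T false false h1 h2)%:R + (T false true h1 h2)%:R / 4 +
    (T true false h1 h2)%:R / 4 + (T true true h1 h2)%:R / 4.
  have T0 s1 s2 : (odd h1 != s1) || (odd h2 != s2) -> T s1 s2 h1 h2 = 0%N.
    rewrite /T => /orP[] o.
      by rewrite (@walks_parity (n.*2 + s1)) ?mul0n //; case: s1 o => o; lia.
    by rewrite (@walks_parity (n'.*2 + s2)) ?muln0 //; case: s2 o => o; lia.
  (* Only the term with the actual parities of the heights is nonzero. *)
  have TT : arm R n h1 * bridge R m h1 h2 * arm R n' h2 =
     (T (odd h1) (odd h2) h1 h2)%:R / 2 ^+ (odd h1 + odd h2 + (odd h1 (+) odd h2)).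
    rewrite /arm /bridge /T oddD !natrM !exprD.
    by rewrite !invfM; ring.
  rewrite TT; case: (odd h1) T0 => T0; case: (odd h2) T0 => T0 /=.
  - by rewrite !(T0 _ false) ?(T0 false) ?orbT // !mul0r !add0r ?addr0; field.
  - by rewrite !(T0 _ true) ?(T0 false) ?orbT // !mul0r !add0r ?addr0; field.
  - by rewrite !(T0 _ false) ?(T0 true) ?orbT // !mul0r !add0r ?addr0; field.
  - by rewrite !(T0 _ true) ?(T0 true) ?orbT // !mul0r ?addr0; field.
under eq_bigr do under eq_bigr do rewrite E.
set c1 := (walks (n + m + n').+1.*2 0 0)%:R.
under eq_bigr do rewrite !(big_split, =^~ mulr_suml, =^~ natr_sum) /=.
rewrite !(big_split, =^~ mulr_suml, =^~ natr_sum) /= !TE /=.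
have -> : (n.*2 + 0 + (m.*2 + 0) + (n'.*2 + 0) = (n + m + n').*2)%N by lia.
have -> : (n.*2 + 0 + (m.*2 + 1) + (n'.*2 + 1) = (n + m + n').+1.*2)%N by lia.
have -> : (n.*2 + 1 + (m.*2 + 1) + (n'.*2 + 0) = (n + m + n').+1.*2)%N by lia.
have -> : (n.*2 + 1 + (m.*2 + 0) + (n'.*2 + 1) = (n + m + n').+1.*2)%N by lia.
by rewrite -/c1; field.
Qed.

(** This separates the two heights, so that the error sum factors. *)
Lemma local_err_split (R : realFieldType) (M : R) (h1 h2 : nat) : 0 < M ->
  local_err R M (h1 + h2).+1%:R <= 4 * (local_err R M h1.+1%:R + local_err R M h2.+1%:R).
Proof.
move=> M0; have M1 : 0 <= M^-1 by rewrite invr_ge0 ltW.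
have M2 : 0 <= M ^- 2 by rewrite invr_ge0 exprn_ge0 // ltW.
rewrite /local_err; set y := (h1 + h2).+1%:R; set y1 := h1.+1%:R; set y2 := h2.+1%:R.
have y10 : 0 <= y1 by []. have y20 : 0 <= y2 by []. have y0 : 0 <= y by [].
have yy : y <= y1 + y2 by rewrite -natrD ler_nat; lia.
clearbody y y1 y2.
have y3 : y ^+ 3 <= 4 * (y1 ^+ 3 + y2 ^+ 3).
  apply: (@le_trans _ _ ((y1 + y2) ^+ 3)).
    by rewrite ler_pXn2r ?nnegrE ?addr_ge0.
  have : 0 <= (y1 + y2) * (y1 - y2) ^+ 2.
    by apply: mulr_ge0; rewrite ?addr_ge0 // sqr_ge0.
  rewrite !exprS expr0; lra.
have -> : 4 * (y1 / M + y1 ^+ 3 / M ^+ 2 + (y2 / M + y2 ^+ 3 / M ^+ 2)) =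
  4 * (y1 + y2) / M + 4 * (y1 ^+ 3 + y2 ^+ 3) / M ^+ 2 by ring.
by rewrite lerD // ler_wpM2r //; lra.
Qed.

Lemma central_le (R : realType) (M : R) (n : nat) : 0 < M -> M <= n%:R ->
  'C(n.*2, n)%:R <= 4 ^+ n / Num.sqrt M.
Proof.
move=> M0 Mn; have c0 := central_gt0 R n.
have -> : 'C(n.*2, n)%:R = 4 ^+ n * central R n.
  by rewrite /central mulrC divfK // expf_neq0 // pnatr_eq0.
rewrite ler_pM2l ?exprn_gt0 //.
have s0 : 0 < Num.sqrt M by rewrite sqrtr_gt0.
rewrite -[leRHS]mul1r ler_pdivlMr //.
have h : (central R n * Num.sqrt M) ^+ 2 <= 1 ^+ 2.
  rewrite expr1n; apply: le_trans (central_upper R n).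
  rewrite exprMn sqr_sqrtr ?(ltW M0) // mulrC ler_wpM2r ?sqr_ge0 //.
  apply: (le_trans Mn); rewrite ler_peMl //.
  by apply: le_trans (pi_ge2 R); lra.
by move: h; rewrite ler_pXn2r ?nnegrE ?mulr_ge0 ?(ltW c0) ?(ltW s0).
Qed.

Lemma term_error (R : realFieldType) (M : R) (n a m b n' h1 h2 : nat) :
  0 < M -> M <= n%:R -> M <= a%:R -> M <= m%:R -> M <= b%:R -> M <= n'%:R ->
  `|stopped_arm R n a h1 * stopped_bridge R m h1 h2 * stopped_arm R n' b h2
    - arm R n h1 * bridge R m h1 h2 * arm R n' h2|
  <= 'C(m.*2, m)%:R * 532 *
     (arm R n h1 * local_err R M h1.+1%:R * arm R n' h2
      + arm R n h1 * (arm R n' h2 * local_err R M h2.+1%:R)).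
Proof.
move=> M0 Mn Ma Mm Mb Mn'.
have [/andP[g0 g1] gd] := stopped_arm_near_arm R M n a h1 M0 Mn Ma.
have [/andP[g0' g1'] gd'] := stopped_arm_near_arm R M n' b h2 M0 Mn' Mb.
have /andP[w0 w1] := bridge_bounds R m h1 h2.
have wd := stopped_bridge_near_bridge R M m h1 h2 M0 Mm.
have es := local_err_split R M h1 h2 M0.
have a0 := arm_ge0 R n h1; have a0' := arm_ge0 R n' h2.
have e0 : 0 <= local_err R M h1.+1%:R by rewrite local_err_ge0.
have e0' : 0 <= local_err R M h2.+1%:R by rewrite local_err_ge0.
move: es wd gd gd' e0 e0' w1; have : 0 <= 'C(m.*2, m)%:R :> R by [].
move: (local_err _ _ (_ + _).+1%:R) (local_err _ _ h1.+1%:R)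
  (local_err _ _ h2.+1%:R) 'C(_, _)%:R.
move: (stopped_arm R n a h1) (stopped_arm R n' b h2) (arm R n h1) (arm R n' h2)
  g0 g1 g0' g1' a0 a0'.
move: (bridge R m h1 h2) (stopped_bridge R m h1 h2) w0.
move=> o w o0 g g' al al' g0 g1 g0' g1' a0 a0' e e1 e2 G G0 es wd gd gd' e10 e20 oG.
have -> : g * w * g' - al * o * al' =
  g * g' * (w - o) + o * ((g - al) * g' + al * (g' - al')) by ring.
have gg : g * g' <= 16 * (al * al').
  by have -> : 16 * (al * al') = 4 * al * (4 * al') by [ring]; rewrite ler_pM.
have p1 : `|g * g' * (w - o)| <= 16 * (al * al') * (8 * G * (4 * (e1 + e2))).
  rewrite normrM (ger0_norm (mulr_ge0 g0 g0')) ler_pM ?mulr_ge0 //.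
  by rewrite (le_trans wd) // ler_wpM2l ?mulr_ge0.
have p2 : `|(g - al) * g'| <= 5 * al * e1 * (4 * al').
  by rewrite normrM (ger0_norm g0') ler_pM.
have p3 : `|al * (g' - al')| <= al * (5 * al' * e2).
  by rewrite normrM (ger0_norm a0) ler_wpM2l.
have p4 : `|o * ((g - al) * g' + al * (g' - al'))| <=
   G * (5 * al * e1 * (4 * al') + al * (5 * al' * e2)).
  rewrite normrM (ger0_norm o0) ler_pM //.
  by rewrite (le_trans (ler_normD _ _)) // lerD.
(* By [p1] and [p4] the constant is 16 * 8 * 4 + 5 * 4. *)
apply: (le_trans (ler_normD _ _)); apply: (le_trans (lerD p1 p4)).
have q1 : 0 <= G * (al * e1 * al') by rewrite !mulr_ge0.
have q2 : 0 <= G * (al * (al' * e2)) by rewrite !mulr_ge0.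
lra.
Qed.

Lemma sum_arm_err_le (R : realFieldType) (M : R) (n K N : nat) :
  0 < M -> M <= n%:R -> (n < N)%N -> (n.*2.+1 < K)%N ->
  \sum_(h < K) arm R n h * local_err R M h.+1%:R <= 4 ^+ n * (14 * N%:R / M ^+ 2).
Proof.
move=> M0 Mn nN nK; rewrite sum_arm_err // ler_pM2l ?exprn_gt0 //.
have nN' : n%:R + 1 <= N%:R :> R by rewrite natr1 ler_nat.
have -> : 2 / M + (12 * n%:R + 5) / M ^+ 2 = (2 * M + 12 * n%:R + 5) / M ^+ 2.
  by field; rewrite gt_eqF.
by rewrite ler_pM2r ?invr_gt0 ?exprn_gt0 //; lra.
Qed.

(** One arm is summed against [local_err], which gives at most
    [14 * 4 ^ n * N / M ^ 2]; the other arm and the bridge contribute a central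
    binomial coefficient each, hence a factor [1 / M] in total. *)
Lemma double_sum_error (R : realType) (M : R) (n a m b n' K N : nat) :
  0 < M -> M <= n%:R -> M <= a%:R -> M <= m%:R -> M <= b%:R -> M <= n'%:R ->
  (n < N)%N -> (n' < N)%N -> (n.*2 + m.*2 + n'.*2 + 2 < K)%N ->
  `|\sum_(h1 < K) \sum_(h2 < K)
       stopped_arm R n a h1 * stopped_bridge R m h1 h2 * stopped_arm R n' b h2
    - ((walks (n + m + n').*2 0 0)%:R + 3 / 4 * (walks (n + m + n').+1.*2 0 0)%:R)|
  <= 532 * 56 * 4 ^+ (n + m + n') * N%:R / M ^+ 3.
Proof.
move=> M0 Mn Ma Mm Mb Mn' nN nN' KK.
have [K1 [K2 K3]] : (n.*2.+1 < K /\ n'.*2.+1 < K /\ n.*2 + m.*2 + 2 < K)%N by lia.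
rewrite -(@sum_arm_bridge_arm _ _ _ _ K) //.
rewrite -sumrB.
under eq_bigr do rewrite -sumrB.
apply: (le_trans (ler_norm_sum _ _ _)).
set G : R := 'C(m.*2, m)%:R.
pose A := \sum_(h < K) arm R n h; pose A' := \sum_(h < K) arm R n' h.
pose E := \sum_(h < K) arm R n h * local_err R M h.+1%:R.
pose E' := \sum_(h < K) arm R n' h * local_err R M h.+1%:R.
apply: (@le_trans _ _ (G * 532 * (E * A' + A * E'))).
  rewrite /E /A !mulr_suml -big_split /= mulr_sumr; apply: ler_sum => h1 _.
  apply: (le_trans (ler_norm_sum _ _ _)).
  rewrite /A' /E' !mulr_sumr -big_split /= mulr_sumr; apply: ler_sum => h2 _.
  exact: term_error.
(* Each of the two products below is bounded with the constant 14 * 2, hence 56. *)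
have Gle : G <= 4 ^+ m / Num.sqrt M by apply: central_le.
have s0 : 0 < Num.sqrt M by rewrite sqrtr_gt0.
have ss : Num.sqrt M ^+ 2 = M by rewrite sqr_sqrtr // ltW.
have Ale : A <= 2 * (4 ^+ n / Num.sqrt M).
  by apply: (le_trans (sum_arm_le _ _ _)); rewrite ler_pM2l // central_le.
have Ale' : A' <= 2 * (4 ^+ n' / Num.sqrt M).
  by apply: (le_trans (sum_arm_le _ _ _)); rewrite ler_pM2l // central_le.
have Ele : E <= 4 ^+ n * (14 * N%:R / M ^+ 2) by apply: sum_arm_err_le.
have Ele' : E' <= 4 ^+ n' * (14 * N%:R / M ^+ 2) by apply: sum_arm_err_le.
have A0 : 0 <= A by apply: sumr_ge0 => h _; exact: arm_ge0.
have A0' : 0 <= A' by apply: sumr_ge0 => h _; exact: arm_ge0.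
have E0 : 0 <= E by apply: sumr_ge0 => h _; rewrite mulr_ge0 ?arm_ge0 ?local_err_ge0.
have E0' : 0 <= E' by apply: sumr_ge0 => h _; rewrite mulr_ge0 ?arm_ge0 ?local_err_ge0.
have G0 : 0 <= G by [].
have b1 := ler_pM E0 A0' Ele Ale'.
have b2 := ler_pM A0 E0' Ale Ele'.
clearbody G.
have G532 : 0 <= G * 532 := mulr_ge0 G0 (ler0n _ _).
have b3 : 0 <= E * A' + A * E' by rewrite addr_ge0 ?mulr_ge0.
have G1 : G * 532 <= 4 ^+ m / Num.sqrt M * 532 := ler_wpM2r (ler0n _ _) Gle.
apply: (le_trans (ler_pM G532 b3 G1 (lerD b1 b2))).
rewrite !exprD; set s := Num.sqrt M in s0 ss *.
have -> : 532 * 56 * (4 ^+ n * 4 ^+ m * 4 ^+ n') * N%:R / M ^+ 3 =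
  532 * 56 * (4 ^+ n * 4 ^+ m * 4 ^+ n' * N%:R / s ^+ 6) by rewrite -ss -exprM; ring.
have -> : 4 ^+ m / s * 532 *
  (4 ^+ n * (14 * N%:R / M ^+ 2) * (2 * (4 ^+ n' / s)) +
   2 * (4 ^+ n / s) * (4 ^+ n' * (14 * N%:R / M ^+ 2))) =
  532 * 56 * (4 ^+ n * 4 ^+ m * 4 ^+ n' * N%:R / s ^+ 6).
  by rewrite -ss -exprM; field; rewrite gt_eqF.
by [].
Qed.

(** * Asymptotics of the probability *)

(** The powers of 2 introduced in the weights compensate exactly. *)
Lemma two_point_count_normalized (R : realFieldType) (n a m b n' K : nat) :
  (\sum_(h1 < K) \sum_(h2 < K)
      walks (n.*2 - h1) 0 h1 * walks (a + h1).*2 0 0 *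
      (if (h1 <= m) && (h2 <= m) then walks (m.*2 - (h1 + h2)) h1 h2 else 0) *
      (walks (b + h2).*2 0 0 * walks (n'.*2 - h2) 0 h2))%N%:R
  = (walks a.*2 0 0)%:R * (walks b.*2 0 0)%:R *
    (\sum_(h1 < K) \sum_(h2 < K)
       stopped_arm R n a h1 * stopped_bridge R m h1 h2 * stopped_arm R n' b h2).
Proof.
rewrite natr_sum mulr_sumr; apply: eq_bigr => h1 _.
rewrite natr_sum mulr_sumr; apply: eq_bigr => h2 _.
rewrite /stopped_arm /stopped_bridge !natrM.
have a0 : (walks a.*2 0 0)%:R != 0 :> R by rewrite pnatr_eq0 -lt0n catalan_gt0.
have b0 : (walks b.*2 0 0)%:R != 0 :> R by rewrite pnatr_eq0 -lt0n catalan_gt0.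
have E h : 4 ^+ h = 2 ^+ h * 2 ^+ h :> R by rewrite -exprMn -natrM.
have p0 h : 2 ^+ h != 0 :> R by rewrite expf_neq0 // pnatr_eq0.
rewrite exprD !E.
move: (walks _ _ _)%:R a0 (walks _ _ _)%:R b0 => ca a0 cb b0.
have := p0 h1; have := p0 h2; move: (2 ^+ h1) (2 ^+ h2) => u v v0 u0.
by field; rewrite a0 b0 u0 v0.
Qed.

(** The quotient of the Catalan number by [4 ^ n / (sqrt pi * n ^ (3/2))]. *)
Definition scaled_catalan (R : realType) (n : nat) : R :=
  (walks n.*2 0 0)%:R * Num.sqrt pi * (n%:R * Num.sqrt n%:R) / 4 ^+ n.

Lemma scaled_catalan_bounds (R : realType) (n : nat) : (0 < n)%N ->
  1 - 2 / n%:R <= scaled_catalan R n <= 1.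
Proof.
move=> n0; have nR : 0 < n%:R :> R by rewrite ltr0n.
have n1 : 0 < n.+1%:R :> R by rewrite ltr0n.
pose y := Num.sqrt (pi * n%:R) * central R n.
have c0 := central_gt0 R n.
have -> : scaled_catalan R n = y * (n%:R / n.+1%:R).
  have := congr1 (fun k => k%:R : R) (catalan_bin n); rewrite natrM.
  rewrite /scaled_catalan /y sqrtrM ?pi_ge0 // /central => <-; field.
  by rewrite expf_neq0 ?pnatr_eq0 //= nat1r pnatr_eq0.
have y0 : 0 <= y by rewrite mulr_ge0 ?sqrtr_ge0 // ltW.
have yy : y ^+ 2 = pi * n%:R * central R n ^+ 2.
  by rewrite exprMn sqr_sqrtr // mulr_ge0 ?pi_ge0.
have y1 : y <= 1.
  have : y ^+ 2 <= 1 ^+ 2 by rewrite yy expr1n central_upper.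
  by rewrite ler_pXn2r ?nnegrE.
have ylo : 2 * n%:R <= n.*2.+1%:R * y.
  apply: (@le_trans _ _ (n.*2.+1%:R * y ^+ 2)).
    have := ler_wpM2l (ltW nR) (central_lower R n); rewrite yy.
    have -> : n%:R * (pi * n.*2.+1%:R * central R n ^+ 2) =
      n.*2.+1%:R * (pi * n%:R * central R n ^+ 2) by ring.
    by rewrite mulrC.
  by rewrite ler_wpM2l // expr2 ler_piMl.
have q1 : n%:R / n.+1%:R <= 1 :> R by rewrite ler_pdivrMr // mul1r ler_nat.
have q0 : 0 <= n%:R / n.+1%:R :> R by rewrite divr_ge0.
apply/andP; split; last by rewrite mulr_ile1.
have yl : 1 - 1 / n%:R <= y.
  have h : 1 - 1 / n%:R = (n%:R - 1) / n%:R :> R by field; rewrite gt_eqF.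
  have n2 : n.*2.+1%:R = 2 * n%:R + 1 :> R by rewrite -natr1 -mul2n natrM.
  rewrite h ler_pdivrMr //; move: ylo; rewrite n2; move: (n%:R) nR => x x0; nra.
have ql : 1 - 1 / n%:R <= n%:R / n.+1%:R :> R.
  rewrite -subr_ge0 -natr1; have n1' : 0 < n%:R + 1 :> R by rewrite natr1.
  have -> : n%:R / (n%:R + 1) - (1 - 1 / n%:R) = 1 / (n%:R * (n%:R + 1)) :> R.
    by field; rewrite !gt_eqF.
  by rewrite divr_ge0 ?mulr_ge0 ?ltW.
have -> : 1 - 2 / n%:R = 1 - 1 / n%:R - 1 / n%:R :> R by ring.
move: (1 / n%:R : R) yl ql => i yl ql.
have : 0 <= (1 - y) * (1 - n%:R / n.+1%:R) by rewrite mulr_ge0 ?subr_ge0.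
move: y (n%:R / n.+1%:R) ql yl {y0 yy y1 ylo q1 q0} => y q ql yl; lra.
Qed.

Lemma near1_mul (R : realFieldType) (x y A B : R) :
  `|x - 1| <= A -> `|y - 1| <= B -> B <= 1 -> `|x * y - 1| <= 2 * A + B.
Proof.
move=> xA yB B1; have -> : x * y - 1 = (x - 1) * y + (y - 1) by ring.
apply: (le_trans (ler_normD _ _)); apply: lerD => //.
rewrite normrM mulrC; apply: ler_pM => //.
move: (le_trans yB B1); rewrite !ler_norml; lra.
Qed.

Lemma near1_inv (R : realFieldType) (x A : R) :
  `|x - 1| <= A -> A <= 1 / 2 -> `|x^-1 - 1| <= 2 * A.
Proof.
move=> xA A1; have A0 := le_trans (normr_ge0 _) xA.
have x0 : 1 / 2 <= x by move: (le_trans xA A1); rewrite ler_norml; lra.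
have xp : 0 < x by lra.
have -> : x^-1 - 1 = x^-1 * (1 - x) by field; rewrite gt_eqF.
rewrite normrM distrC normfV (gtr0_norm xp); apply: ler_pM => //.
  by rewrite invr_ge0 ltW.
rewrite -[leRHS]invrK lef_pV2 ?posrE ?invr_gt0 //; lra.
Qed.

Lemma powR32 (R : realType) (x : R) : 0 < x -> x `^ (3 / 2) = x * Num.sqrt x.
Proof.
move=> x0; have -> : 3 / 2 = 1 + 1 / 2 :> R by field.
rewrite powRD; last by apply/implyP => _; rewrite gt_eqF.
by rewrite powRr1 ?ltW // -powR12_sqrt ?ltW // div1r.
Qed.

(** Asymptotically [Cat k] and [Cat (k + 1)] are 1/16 and 1/4 of
    [Cat (k + 2)], and [1/16 + 3/4 * 1/4 = 1/4]. *)
Lemma catalan_mix (R : realFieldType) (k : nat) (M : R) : 8 <= M -> M <= k%:R ->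
  `|4 * ((walks k.*2 0 0)%:R + 3 / 4 * (walks k.+1.*2 0 0)%:R)
    / (walks k.+2.*2 0 0)%:R - 1| <= 8 / M.
Proof.
move=> M8 Mk; have M0 : 0 < M by lra.
have k0 : 0 < k%:R :> R by lra.
have kn : (0 < k)%N by rewrite -(ltr0n R).
have c0 : 0 < (walks k.*2 0 0)%:R :> R by rewrite ltr0n catalan_gt0.
have /andP[] := catalan_growth R k 1 kn; have /andP[] := catalan_growth R k 2 kn.
rewrite addn1 addn2.
set c := (walks k.*2 0 0)%:R in c0 *; set c1 := (walks k.+1.*2 0 0)%:R.
set c2 := (walks k.+2.*2 0 0)%:R.
move Ek2 : (c2 / _) => k2; move Ek1 : (c1 / _) => k1.
have -> : c2 = 16 * c * k2 by rewrite -Ek2; field; rewrite gt_eqF.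
have -> : c1 = 4 * c * k1 by rewrite -Ek1; field; rewrite gt_eqF.
have iM : k%:R^-1 <= M^-1 by rewrite lef_pV2 ?posrE.
have iM8 : M^-1 <= 8^-1 by rewrite lef_pV2 ?posrE.
move: (k%:R^-1) iM => i iM l2 u2 l1 u1.
have k20 : 1 / 2 <= k2 by lra.
have -> : 4 * (c + 3 / 4 * (4 * c * k1)) / (16 * c * k2) - 1 =
  (4 * k2)^-1 * (1 + 3 * k1 - 4 * k2) by field; rewrite !gt_eqF //; lra.
have k40 : 0 <= 4 * k2 by lra.
rewrite normrM normfV (ger0_norm k40).
rewrite (_ : 8 / M = 2^-1 * (16 / M)); last by field; rewrite gt_eqF.
apply: ler_pM => //.
- by rewrite invr_ge0; lra.
- by rewrite lef_pV2 ?posrE; lra.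
- by rewrite ler_norml; apply/andP; split; lra.
Qed.

(** All powers of 4, all factors [sqrt pi] but two, and all [x ^ (3/2)] are
    collected by writing each Catalan number with [scaled_catalan]; [1 + delta]
    is what remains, a product of four scaled Catalan numbers or inverses and of
    the ratio of [T] to [Cat (N - a - b) / 4]. *)
Lemma probability_asymptotics (R : realType) (c M T : R) (a b k N : nat) :
  0 <= c -> N = (a + b + k.+2)%N -> 60 <= M -> M <= a%:R -> M <= b%:R -> M <= k%:R ->
  `|T - ((walks k.*2 0 0)%:R + 3 / 4 * (walks k.+1.*2 0 0)%:R)|
    <= c * 4 ^+ k * N%:R / M ^+ 3 ->
  exists delta : R,
   `|delta| <= 76 / M + 2 * (c * N%:R * (N%:R * Num.sqrt N%:R) / M ^+ 3) /\
   (walks a.*2 0 0)%:R * (walks b.*2 0 0)%:R * T / (walks N.*2 0 0)%:R =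
   N%:R ^- 3 / (4 * pi * (1 - (a%:R + b%:R) / N%:R) `^ (3 / 2)
     * (a%:R / N%:R) `^ (3 / 2) * (b%:R / N%:R) `^ (3 / 2)) * (1 + delta).
Proof.
move=> c0 EN M60 Ma Mb Mk TE.
have M0 : 0 < M by lra.
have pos x : M <= x%:R -> 0 < x%:R :> R by move=> ?; lra.
have posn x : M <= x%:R -> (0 < x)%N by move=> ?; rewrite -(ltr0n R) pos.
have Mk2 : M <= k.+2%:R by rewrite (le_trans Mk) // ler_nat; lia.
have MN : M <= N%:R by rewrite (le_trans Mk) // ler_nat; lia.
have k2N : k.+2%:R <= N%:R :> R by rewrite ler_nat; lia.
have ENR : N%:R = a%:R + b%:R + k.+2%:R :> R by rewrite EN !natrD.
have E4 : 4 ^+ N = 4 ^+ a * 4 ^+ b * 4 ^+ k.+2 :> R by rewrite EN !exprD.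
have sc x : M <= x%:R -> `|scaled_catalan R x - 1| <= 2 / M.
  move=> Mx; have /andP[l u] := scaled_catalan_bounds R x (posn x Mx).
  have h : 2 / x%:R <= 2 / M by rewrite ler_pM2l // lef_pV2 ?posrE // pos.
  have h0 : 0 <= 2 / M by rewrite divr_ge0 // ltW.
  by rewrite ler_norml; apply/andP; split; lra.
have Mi : M^-1 <= 60^-1 by rewrite lef_pV2 ?posrE.
have sg x : M <= x%:R -> 1 / 2 <= scaled_catalan R x.
  by move=> /sc; rewrite ler_norml; lra.
pose r (x : R) := x * Num.sqrt x.
have r0 x : 0 < x -> 0 < r x by move=> x0; rewrite mulr_gt0 ?sqrtr_gt0.
pose sp : R := Num.sqrt pi.
have sp0 : 0 < sp by rewrite sqrtr_gt0 pi_gt0.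
have sp2 : sp ^+ 2 = pi by rewrite sqr_sqrtr // pi_ge0.
have sple : sp <= 2.
  have : sp ^+ 2 <= 2 ^+ 2 by rewrite sp2; have := pihalf_lt2 R; lra.
  by rewrite ler_pXn2r ?nnegrE // ltW.
have catE x : M <= x%:R ->
    (walks x.*2 0 0)%:R = scaled_catalan R x * 4 ^+ x / (sp * r x%:R).
  move=> Mx; rewrite /scaled_catalan -/sp -/(r _) divfK ?expf_neq0 ?pnatr_eq0 //.
  by rewrite -mulrA mulfK // mulf_neq0 // gt_eqF // r0 // pos.
pose C2 : R := (walks k.+2.*2 0 0)%:R.
have C20 : 0 < C2 by rewrite ltr0n catalan_gt0.
pose f5 := 4 * T / C2.
pose E := c * N%:R * r N%:R / M ^+ 3.
have f5E : `|f5 - 1| <= 8 / M + E.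
  (* The error splits into the one of [catalan_mix] and the one of [T]. *)
  have mix := catalan_mix R k M _ Mk; move: TE mix; rewrite -/C2.
  set T0 := _ + 3 / 4 * _ => TE mix.
  have -> : f5 - 1 = (4 * T0 / C2 - 1) + 4 * (T - T0) / C2 by rewrite /f5; ring.
  apply: (le_trans (ler_normD _ _)); apply: lerD; first by apply: mix; lra.
  rewrite normrM normfV (gtr0_norm C20) normrM ger0_norm //.
  rewrite ler_pdivrMr //; apply: (le_trans (ler_wpM2l _ TE)) => //.
  have rN : r k.+2%:R <= r N%:R.
    by rewrite ler_pM ?sqrtr_ge0 // ler_wsqrtr.
  have kp := r0 _ (pos _ Mk2).
  rewrite /C2 (catE _ Mk2) /E.
  have s2 := sg _ Mk2.
  have h : 4 * (sp * r k.+2%:R) <= scaled_catalan R k.+2 * (16 * r N%:R).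
    have h1 : sp * r k.+2%:R <= 2 * r N%:R by rewrite ler_pM // ltW.
    have h2 : 1 / 2 * (16 * r N%:R) <= scaled_catalan R k.+2 * (16 * r N%:R).
      by rewrite ler_wpM2r // mulr_ge0 // ltW // (lt_le_trans kp).
    lra.
  have X0 : 0 <= c * 4 ^+ k * N%:R / M ^+ 3.
    by rewrite divr_ge0 ?mulr_ge0 ?exprn_ge0 // ltW.
  have -> : c * N%:R * r N%:R / M ^+ 3 *
    (scaled_catalan R k.+2 * 4 ^+ k.+2 / (sp * r k.+2%:R)) =
    c * 4 ^+ k * N%:R / M ^+ 3 *
      (scaled_catalan R k.+2 * (16 * r N%:R)) / (sp * r k.+2%:R).
    by rewrite !exprS; ring.
  rewrite ler_pdivlMr ?mulr_gt0 // mulrAC mulrC ler_wpM2l //.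
have E0 : 0 <= E by rewrite divr_ge0 ?mulr_ge0 ?sqrtr_ge0 ?exprn_ge0 // ltW.
pose f := scaled_catalan R a * scaled_catalan R b * scaled_catalan R k.+2
  * (scaled_catalan R N)^-1.
have fE : `|f - 1| <= 60 / M.
  (* Four factors, each within [4 / M] of 1. *)
  have v1 : 4 / M <= 1 by lra.
  have v2 x : M <= x%:R -> `|scaled_catalan R x - 1| <= 4 / M.
    by move=> /sc h; apply: (le_trans h); rewrite ler_wpM2r ?invr_ge0 ?ltW //; lra.
  have h1 := near1_mul _ _ _ _ _ (v2 _ Ma) (v2 _ Mb) v1.
  have h2 := near1_mul _ _ _ _ _ h1 (v2 _ Mk2) v1.
  have h3 : `|(scaled_catalan R N)^-1 - 1| <= 4 / M.
    by have -> : 4 / M = 2 * (2 / M) by [ring]; apply: near1_inv (sc _ MN) _; lra.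
  by apply: (le_trans (near1_mul _ _ _ _ _ h2 h3 v1)); lra.
exists (f5 * f - 1); split.
  have := near1_mul _ _ _ _ _ f5E fE; rewrite -/E.
  by move=> h; apply: (le_trans (h _)); lra.
have -> : 1 + (f5 * f - 1) = f5 * f by ring.
have N0 := pos _ MN.
have ratio x : 0 < x -> (x / N%:R) `^ (3 / 2) = r x / r N%:R.
  move=> x0; rewrite powR32 ?divr_gt0 // /r sqrtrM ?ltW // sqrtrV ?ltW //.
  by rewrite invfM mulrACA.
have -> : 1 - (a%:R + b%:R) / N%:R = k.+2%:R / N%:R :> R.
  by apply: (mulIf (lt0r_neq0 N0)); rewrite mulrBl !divfK ?gt_eqF // ENR; ring.
rewrite !ratio ?pos //.
have -> : N%:R ^- 3 = r N%:R ^- 2.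
  by congr (_^-1); rewrite /r exprMn sqr_sqrtr ?ltW // -exprSr.
have TE5 : T = f5 * C2 / 4 by rewrite /f5; field; rewrite gt_eqF.
rewrite TE5 /C2 !catE // E4 -sp2 /f.
have := r0 _ (pos _ Ma); have := r0 _ (pos _ Mb); have := r0 _ (pos _ Mk2); have := r0 _ N0.
have := sg _ MN.
move: (scaled_catalan R N) (scaled_catalan R a) (scaled_catalan R b) (scaled_catalan R k.+2).
move: (r N%:R) (r a%:R) (r b%:R) (r k.+2%:R) => rN ra rb rk sN sa sb sk sN0 rN0 rk0 rb0 ra0.
have p0 x : (4 : R) ^+ x != 0 by rewrite expf_neq0 // pnatr_eq0.
have := p0 a; have := p0 b; have := p0 k.+2.
move: (4 ^+ a) (4 ^+ b) (4 ^+ k.+2) f5 {TE5 f5E} => qa qb qk f5 qk0 qb0 qa0.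
field.
by rewrite qa0 qb0 qk0 !gt_eqF //; lra.
Qed.

Lemma P312_Sup (R : realType) (n a m b n' N K : nat) (t1 t2 j1 j2 : int) :
  N = (n + a + m + b + n' + 2)%N -> (N <= K)%N ->
  j1 = n.+1%:Z -> N%:Z - t1 = (n + a).+1%:Z ->
  j2 = (n + a + 1 + m).+1%:Z -> N%:Z - t2 = (n + a + 1 + m + b).+1%:Z ->
  P312 R (Sup N t1 t2 j1 j2) =
  (walks a.*2 0 0)%:R * (walks b.*2 0 0)%:R *
    (\sum_(h1 < K) \sum_(h2 < K)
       stopped_arm R n a h1 * stopped_bridge R m h1 h2 * stopped_arm R n' b h2)
  / (walks N.*2 0 0)%:R.
Proof.
move=> EN NK E1 E2 E3 E4.
by rewrite /P312 card_S312_catalan (card_Sup n a m b n' N K) // two_point_count_normalized.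
Qed.

Lemma powR_ge_sqrtV (R : realType) (theta : R) (N : nat) : 0 < theta -> (0 < N)%N ->
  (Num.sqrt N%:R)^-1 <= N%:R `^ (3 * theta - 1 / 2).
Proof.
move=> th N0; have -> : (Num.sqrt N%:R)^-1 = N%:R `^ (- (1 / 2)) :> R.
  by rewrite powRN div1r powR12_sqrt.
by apply: ler_powR; [rewrite ler1n | lra].
Qed.

(** The coordinates of [count_two_points], where positions and values
    start from 0. *)
Lemma gap_coordinates (N n a m b n' : nat) (j1 j2 t1 t2 : int) :
  j1 = n.+1%:Z -> N%:Z - t1 - j1 = a%:Z -> j2 - (N%:Z - t1) = m.+1%:Z ->
  N%:Z - t2 - j2 = b%:Z -> t2 = n'%:Z ->
  [/\ N = (n + a + m + b + n' + 2)%N, N%:Z - t1 = (n + a).+1%:Z,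
      j2 = (n + a + 1 + m).+1%:Z & N%:Z - t2 = (n + a + 1 + m + b).+1%:Z].
Proof. by move=> -> Ea Em Eb Et; split; lia. Qed.

Lemma gap_bounds (N n a m b n' : nat) :
  N = (n + a + m + b + n' + 2)%N ->
  [/\ (n < N)%N, (n' < N)%N, (n.*2 + m.*2 + n'.*2 + 2 < 2 * N + 3)%N &
      N = (a + b + (n + m + n').+2)%N].
Proof. by move=> ->; split; lia. Qed.

Theorem theorem2p11 (R : realType) (theta : R)
    (theta_gt0 : 0 < theta) (theta_lt : theta < 1 / 6) :
  forall eps : R, 0 < eps ->
  exists (C : R) (N1 : nat),
  forall (N : nat) (j1 j2 t1 t2 : int),
    (N1 <= N)%N ->
    eps * N%:R < j1%:~R ->
    eps * N%:R < (N%:Z - t1 - j1)%:~R ->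
    eps * N%:R < (j2 - (N%:Z - t1))%:~R ->
    eps * N%:R < (N%:Z - t2 - j2)%:~R ->
    eps * N%:R < t2%:~R ->
    let a : R := (N%:Z - t1 - j1)%:~R in
    let b : R := (N%:Z - t2 - j2)%:~R in
    exists delta : R,
      `|delta| <= C * N%:R `^ (3 * theta - 1 / 2) /\
      P312 R (Sup N t1 t2 j1 j2) =
        N%:R ^- 3 /
          (4 * pi
           * (1 - (a + b) / N%:R) `^ (3 / 2)
           * (a / N%:R) `^ (3 / 2)
           * (b / N%:R) `^ (3 / 2))
        * (1 + delta).
Proof.
(* Half of [eps]: two of the five gaps are one larger than the step numbers
   [n] and [m] to which the bounds apply. *)
move=> eps eps0; pose e := eps / 2.
have e0 : 0 < e by rewrite divr_gt0.
pose C := 76 / e + 2 * (532 * 56 / e ^+ 3).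
(* This threshold gives [M >= 60], so that the error [60 / M] of the product
   of scaled Catalan numbers is at most 1. *)
exists C, (Num.truncn (60 / e)).+1 => N j1 j2 t1 t2 NN1 H1 Ha Hm Hb Ht a b.
have NR : 60 / e < N%:R by apply: (lt_le_trans (truncnS_gt _)); rewrite ler_nat.
pose M := e * N%:R.
have M60 : 60 <= M by rewrite /M mulrC -ler_pdivrMr // ltW.
have N0 : 0 < N%:R :> R by apply: lt_trans NR; rewrite divr_gt0.
have EM : eps * N%:R = 2 * M by rewrite /M /e; field.
rewrite EM in H1 Ha Hm Hb Ht.
have pos (z : int) : 2 * M < z%:~R -> exists k : nat, z = k.+1%:Z.
  move=> h; have : 0 < z by rewrite -(ltr0z R); lra.
  by case: z {h} => [[|k]|k] // _; exists k.
have [n E1] := pos _ H1; have [a' Ea] := pos _ Ha; have [m Em] := pos _ Hm.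
have [b' Eb] := pos _ Hb; have [n' Et] := pos _ Ht.
rewrite /a /b Ea Eb {a b}; rewrite E1 in H1; rewrite Em in Hm.
rewrite Ea in Ha; rewrite Eb in Hb; rewrite Et in Ht.
rewrite -!pmulrn in H1 Ha Hm Hb Ht *.
move: Ea Ha Eb Hb Et Ht; move: (a'.+1) (b'.+1) (n'.+1) => {a' b' n'} a' b' n'.
move=> Ea Ha Eb Hb Et Ht.
have [EN F1 F2 F3] := gap_coordinates _ _ _ _ _ _ _ _ _ _ E1 Ea Em Eb Et.
have [nN nN' KK EN2] := gap_bounds _ _ _ _ _ _ EN.
have Mn : M <= n%:R by move: H1; rewrite -natr1; lra.
have Ma : M <= a'%:R by lra.
have Mm : M <= m%:R by move: Hm; rewrite -natr1; lra.
have Mb : M <= b'%:R by lra.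
have Mn' : M <= n'%:R by lra.
have M0 : 0 < M by lra.
pose K := (2 * N + 3)%N.
have sum_err := double_sum_error R M n a' m b' n' K N M0 Mn Ma Mm Mb Mn'.
have {}sum_err := sum_err nN nN' KK.
have Mk : M <= (n + m + n')%:R by rewrite (le_trans Mn) // ler_nat -addnA leq_addr.
have [delta [dle dE]] :=
  probability_asymptotics R (532 * 56) M _ a' b' (n + m + n') N
    (mulr_ge0 (ler0n _ _) (ler0n _ _)) EN2 M60 Ma Mb Mk sum_err.
exists delta; split; last first.
  by rewrite (P312_Sup R n a' m b' n' N K) // ?dE // /K mulSn -addnA leq_addr.
have NP := powR_ge_sqrtV R theta N theta_gt0 (leq_ltn_trans (leq0n n) nN).
have C0 : 0 <= C.
  apply: addr_ge0; first exact: divr_ge0 (ler0n _ _) (ltW e0).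
  apply: mulr_ge0 (ler0n _ _) (divr_ge0 _ (exprn_ge0 3 (ltW e0))).
  exact: mulr_ge0 (ler0n _ _) (ler0n _ _).
apply: (le_trans dle); apply: le_trans (ler_wpM2l C0 NP).
set s := Num.sqrt N%:R; have s0 : 0 < s by rewrite sqrtr_gt0.
have ss : N%:R = s ^+ 2 by rewrite sqr_sqrtr // ltW.
have s1 : 1 <= s.
  have : 1 ^+ 2 <= s ^+ 2 by rewrite -ss expr1n ler1n (leq_ltn_trans (leq0n n) nN).
  by rewrite ler_pXn2r ?nnegrE // ltW.
have -> : 76 / M = 76 / e * (s^-1 * s^-1) by rewrite /M ss; field; rewrite !gt_eqF.
have -> : 532 * 56 * N%:R * (N%:R * s) / M ^+ 3 = 532 * 56 / e ^+ 3 / s.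
  by rewrite /M ss; field; rewrite !gt_eqF.
rewrite /C (mulrDl (76 / e)) lerD //; last by rewrite [leLHS]mulrA.
apply: ler_wpM2l; first by rewrite divr_ge0 ?(ltW e0).
rewrite ler_piMr ?invr_ge0 ?(ltW s0) //.
by rewrite invf_le1.
Qed.
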